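(* There exist absolute constants $\alpha>1$ and $C>0$ with the following property: for every $n\geq 1$ and every family $\{P_i : i\in I\}$ of closed half-spaces $$P_i=\{x\in\mathbb{R}^n : \langle x,v_i\rangle\leq 1\},\qquad v_i\in\mathbb{R}^n,$$ in $\mathbb{R}^n$ such that $P=\bigcap_{i\in I}P_i$ has positive volume, there exist $s\leq\alpha n$ and $i_1,\ldots,i_s\in I$ such that $$|P_{i_1}\cap\cdots\cap P_{i_s}|\leq (Cn)^n\,|P|.$$
   Context: $|\cdot|$ denotes $n$-dimensional volume (Lebesgue measure) in $\mathbb{R}^n$, with values in $[0,+\infty]$; $\langle\cdot,\cdot\rangle$ is the Euclidean inner product; $s$ is an integer. The family may be infinite. ''Absolute constant'' means a constant independent of $n$ and of the family. *)

(* Defs.v *)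
From HB Require Import structures.
From mathcomp Require Import all_boot all_order all_algebra.
From mathcomp Require Import all_classical all_reals all_analysis.
Set Implicit Arguments.
Unset Strict Implicit.
Unset Printing Implicit Defensive.
Import Order.TTheory GRing.Theory Num.Theory.
Import numFieldNormedType.Exports.
Local Open Scope classical_set_scope.
Local Open Scope ring_scope.

Section lebesgue_tuple.
Variable R : realType.
Local Notation RR := (measurableTypeR R).

Definition tuple_of_pair n (p : RR * n.-tuple RR) : n.+1.-tuple RR :=
  [tuple of p.1 :: p.2].

(* The library has no Lebesgue measure on R^n for variable n; this is the
   n-fold product of its one-dimensional Lebesgue measure. *)
Fixpoint lebesgue_tuple n : set (n.-tuple RR) -> \bar R :=
  match n with
  | 0 => dirac ([tuple] : 0.-tuple RR)
  | n'.+1 => pushforward (@lebesgue_measure R \x @lebesgue_tuple n')%E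
                         (@tuple_of_pair n')
  end.

Lemma measurable_tuple_of_pair n : measurable_fun setT (@tuple_of_pair n).
Proof. exact: (measurable_cons measurable_fst measurable_snd). Qed.

Lemma lebesgue_tuple_is_sigma_finite n :
  {mu : {sigma_finite_measure set (n.-tuple RR) -> \bar R} |
    mu = @lebesgue_tuple n :> (set (n.-tuple RR) -> \bar R)}.
Proof.
elim: n => [|n [mu muE]].
  by exists (dirac ([tuple] : 0.-tuple RR)).
pose nu0 := (@lebesgue_measure R \x mu)%E.
have mf := @measurable_tuple_of_pair n.
pose nu : {measure set (n.+1.-tuple RR) -> \bar R} :=
  measure_function_pushforward__canonical__measure_function_Measure nu0 mf.
have nuE : nu = @lebesgue_tuple n.+1 :> (set _ -> \bar R) by rewrite /= -muE.
have nuS : sigma_finite setT (@lebesgue_tuple n.+1).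
  rewrite -nuE.
  have /sigma_finiteP[F [FT ndF Foo]] := sigma_finiteT (@lebesgue_measure R).
  have /sigma_finiteP[G [GT ndG Goo]] := sigma_finiteT mu.
  pose H k : set (n.+1.-tuple RR) :=
    (@tnth _ RR ^~ ord0) @^-1` F k `&` (fun t : n.+1.-tuple RR => [tuple of behead t] : n.-tuple RR) @^-1` G k.
  have HE k : @tuple_of_pair n @^-1` H k = F k `*` G k.
    apply/seteqP; split => -[x y] /= -[]; rewrite /H /= => Fx Gy; split => //=.
      by move: Gy; congr (G k _); exact: val_inj.
    by move: Gy; congr (G k _); exact: val_inj.
  exists H.
    apply/seteqP; split => // t _.
    have : [set: RR] (tnth t ord0) by [].
    rewrite FT => -[i _ Fi].
    have : [set: n.-tuple RR] [tuple of behead t] by [].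
    rewrite GT => -[j _ Gj].
    exists (maxn i j) => //; split => /=.
    - by move: Fi; exact/subsetPset/ndF/leq_maxl.
    - by move: Gj; exact/subsetPset/ndG/leq_maxr.
  move=> k; have [mF Foo'] := Foo k; have [mG Goo'] := Goo k; split.
    apply: measurableI.
      by rewrite -[X in measurable X]setTI; exact: measurable_tnth.
    by rewrite -[X in measurable X]setTI; exact: measurable_behead.
  rewrite /nu /= /pushforward HE product_measure1E//.
  by rewrite lte_mul_pinfty// ge0_fin_numE.
have n0 : @lebesgue_tuple n.+1 set0 = 0%E by rewrite -nuE measure0.
have n1 A : (0 <= @lebesgue_tuple n.+1 A)%E by rewrite -nuE measure_ge0.
have n2 : semi_sigma_additive (@lebesgue_tuple n.+1).
  by rewrite -nuE; exact: measure_semi_sigma_additive.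
pose M := isMeasure.Build _ _ _ (@lebesgue_tuple n.+1) n0 n1 n2.
pose nuM : {measure set (n.+1.-tuple RR) -> \bar R} :=
  HB.pack (@lebesgue_tuple n.+1) M.
pose S := Measure_isSigmaFinite.Build _ _ _ nuM nuS.
pose nu' : {sigma_finite_measure set (n.+1.-tuple RR) -> \bar R} :=
  HB.pack (@lebesgue_tuple n.+1) M S.
by exists nu'.
Qed.

Section instances.
Variable n : nat.

Let leb0 : @lebesgue_tuple n set0 = 0%E.
Proof. by case: (lebesgue_tuple_is_sigma_finite n) => mu <-; exact: measure0. Qed.

Let leb_ge0 A : (0 <= @lebesgue_tuple n A)%E.
Proof.
by case: (lebesgue_tuple_is_sigma_finite n) => mu <-; exact: measure_ge0.
Qed.

Let leb_sigma_additive : semi_sigma_additive (@lebesgue_tuple n).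
Proof.
case: (lebesgue_tuple_is_sigma_finite n) => mu <-.
exact: measure_semi_sigma_additive.
Qed.

HB.instance Definition _ := isMeasure.Build _ _ _ (@lebesgue_tuple n)
  leb0 leb_ge0 leb_sigma_additive.

Let leb_sigma_finite : sigma_finite setT (@lebesgue_tuple n).
Proof.
by case: (lebesgue_tuple_is_sigma_finite n) => mu <-; exact: sigma_finiteT.
Qed.

HB.instance Definition _ := Measure_isSigmaFinite.Build _ _ _
  (@lebesgue_tuple n) leb_sigma_finite.

End instances.

(* n-dimensional Lebesgue measure on R^n = 'rV_n, read through coordinates; it is
   meaningful on Borel sets (intersections of closed half-spaces are closed). *)
Definition volume n (A : set 'rV[R]_n) : \bar R :=
  lebesgue_tuple [set t : n.-tuple RR | A (\row_i tnth t i)].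

Lemma volume_box n (a b : 'rV[R]_n) : (forall i, a 0 i <= b 0 i) ->
  volume [set x | forall i, a 0 i <= x 0 i <= b 0 i] =
  (\prod_(i < n) (b 0 i - a 0 i))%:E.
Proof.
suff H : forall (f g : 'I_n -> R), (forall i, f i <= g i) ->
  lebesgue_tuple [set t : n.-tuple RR | forall i, f i <= tnth t i <= g i] =
  (\prod_(i < n) (g i - f i))%:E.
  move=> ab; rewrite -(H (a 0) (b 0) ab) /volume; congr lebesgue_tuple.
  by apply/seteqP; split => t /= + i => /(_ i); rewrite mxE.
elim: n {a b} => [|n IH] f g fg.
  by rewrite big_ord0 /= diracE mem_set// => -[].
rewrite /= /pushforward.
rewrite [X in (_ \x _)%E X](_ : _ = `[f ord0, g ord0]%classic `*`
    [set t : n.-tuple RR | forall i, f (lift ord0 i) <= tnth t i <= g (lift ord0 i)]).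
  rewrite product_measure1E//=.
  - rewrite IH// lebesgue_measure_itv/= lte_fin big_ord_recl EFinM.
    have := fg ord0; rewrite le_eqVlt => /predU1P[->|->//].
    by rewrite ltxx subrr !mul0e.
  - rewrite (_ : [set _ | _] = \bigcap_(i in [set: 'I_n])
      ((@tnth n RR ^~ i) @^-1` `[f (lift ord0 i), g (lift ord0 i)]%classic)).
      apply: fin_bigcap_measurable => // i _.
      by rewrite -[X in measurable X]setTI; exact: measurable_tnth.
    by apply/seteqP; split => t /= H i; have := H i; rewrite /= in_itv/=; exact.
apply/seteqP; split => -[x t] /=.
  move=> H; split => /=; first by rewrite in_itv /=; exact: (H ord0).
  by move=> i; have := H (lift ord0 i); rewrite tnthS.
rewrite in_itv /= => -[H0 H] i; case: (unliftP ord0 i) => [j|] ->//.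
by rewrite tnthS.
Qed.

Definition dotv n (x y : 'rV[R]_n) : R := \sum_(i < n) x 0 i * y 0 i.

Definition halfspace n (v : 'rV[R]_n) : set 'rV[R]_n := [set x | dotv x v <= 1].

End lebesgue_tuple.

(* Main.v *)
Require Import Defs.
From mathcomp Require Import all_boot all_order all_algebra.
From mathcomp Require Import all_classical all_reals all_analysis.
From mathcomp Require Import measurable_realfun.
From mathcomp Require Import ring lra.
Import Order.TTheory GRing.Theory Num.Theory.
Import numFieldNormedType.Exports.
Local Open Scope classical_set_scope.
Local Open Scope ring_scope.
Set Implicit Arguments.
Unset Strict Implicit.
Unset Printing Implicit Defensive.

(** Move P by an affine map so that the unit ball is an (almost) maximal-volume
ellipsoid in P; the half-spaces become <x, v> <= 1 with |v| <= 1.  Comparing the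
ball with the nearby ellipsoids (I + tS)B + tb gives John's theorem in the weak
form: for all S and b some v satisfies <Sv, v> + <b, v> >= tr S / n, up to a
small error.  With S = x x^T this gives |x| <= 2n on P.  With
S = pi - q s s^T / 80, where pi is the projection orthogonal to u_1, ..., u_k,
q = (n - k) / n and s = u_1 + ... + u_k, it selects greedily u_1, ..., u_n such
that det(u_1, ..., u_n)^2 >= n! / (4n)^n while |u_1 + ... + u_n|^2 = O(n).  Hence
- <x, u_1 + ... + u_n> = O(n^(3/2)) on P, and by compactness and Helly's theorem
n + 1 of the half-spaces already imply this inequality.  The 2n + 1 selected
half-spaces cut out a subset of a simplex with volume at most
(C n^(3/2))^n / (n! |det(u_1, ..., u_n)|) <= (C' sqrt n)^n, whereas P contains
the cube of side 2 / sqrt n. *)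

(** * The inner product and determinants *)

Section dotv.
Variable R : realType.
Implicit Types n : nat.

Lemma dotvE n (x y : 'rV[R]_n) : dotv x y = (x *m y^T) 0 0.
Proof. by rewrite mxE; apply: eq_bigr => i _; rewrite mxE. Qed.

Lemma dotvC n (x y : 'rV[R]_n) : dotv x y = dotv y x.
Proof. by apply: eq_bigr => i _; rewrite mulrC. Qed.

Lemma dotvDl n (x y z : 'rV[R]_n) : dotv (x + y) z = dotv x z + dotv y z.
Proof. by rewrite -big_split; apply: eq_bigr => i _; rewrite mxE mulrDl. Qed.

Lemma dotvZl n a (x z : 'rV[R]_n) : dotv (a *: x) z = a * dotv x z.
Proof. by rewrite mulr_sumr; apply: eq_bigr => i _; rewrite mxE mulrA. Qed.

Lemma dotvNl n (x z : 'rV[R]_n) : dotv (- x) z = - dotv x z.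
Proof. by rewrite -scaleN1r dotvZl mulN1r. Qed.

Lemma dotvBl n (x y z : 'rV[R]_n) : dotv (x - y) z = dotv x z - dotv y z.
Proof. by rewrite dotvDl dotvNl. Qed.

Lemma dotvDr n (x y z : 'rV[R]_n) : dotv z (x + y) = dotv z x + dotv z y.
Proof. by rewrite !(dotvC z) dotvDl. Qed.

Lemma dotvZr n a (x z : 'rV[R]_n) : dotv z (a *: x) = a * dotv z x.
Proof. by rewrite !(dotvC z) dotvZl. Qed.

Lemma dotvNr n (x z : 'rV[R]_n) : dotv z (- x) = - dotv z x.
Proof. by rewrite !(dotvC z) dotvNl. Qed.

Lemma dotvBr n (x y z : 'rV[R]_n) : dotv z (x - y) = dotv z x - dotv z y.
Proof. by rewrite dotvDr dotvNr. Qed.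

Lemma dotv0l n (z : 'rV[R]_n) : dotv 0 z = 0.
Proof. by rewrite -(scale0r z) dotvZl mul0r. Qed.

Lemma dotv0r n (z : 'rV[R]_n) : dotv z 0 = 0.
Proof. by rewrite dotvC dotv0l. Qed.

Lemma dotv_suml n (T : finType) (P : pred T) (F : T -> 'rV[R]_n) z :
  dotv (\sum_(i | P i) F i) z = \sum_(i | P i) dotv (F i) z.
Proof.
elim/big_rec2: _ => [|i a b _ <-]; first by rewrite dotv0l.
by rewrite dotvDl.
Qed.

Lemma dotv_mulmx m n (A : 'M[R]_(m, n)) (x : 'rV_m) (y : 'rV_n) :
  dotv (x *m A) y = dotv x (y *m A^T).
Proof. by rewrite !dotvE trmx_mul trmxK mulmxA. Qed.

Lemma dotv_ge0 n (x : 'rV[R]_n) : 0 <= dotv x x.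
Proof. by apply: sumr_ge0 => i _; rewrite -expr2 sqr_ge0. Qed.

Lemma dotv_eq0 n (x : 'rV[R]_n) : (dotv x x == 0) = (x == 0).
Proof.
apply/eqP/eqP => [|->]; last by rewrite dotv0l.
move=> /psumr_eq0P x0; apply/rowP => i; rewrite mxE; apply/eqP.
by rewrite -[_ == _]orbb -mulf_eq0 x0// => j _; rewrite -expr2 sqr_ge0.
Qed.

Lemma dotv_sqr_le n (x y : 'rV[R]_n) : dotv x y ^+ 2 <= dotv x x * dotv y y.
Proof.
have [->|y0] := eqVneq y 0; first by rewrite !dotv0r expr0n mulr0.
have yy : 0 < dotv y y by rewrite lt_neqAle eq_sym dotv_eq0 y0 dotv_ge0.
have := dotv_ge0 (dotv y y *: x - dotv x y *: y).
rewrite dotvBl !dotvBr !dotvZl !dotvZr (dotvC y x).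
rewrite (_ : _ - _ = dotv y y * (dotv x x * dotv y y - dotv x y ^+ 2)); last ring.
by rewrite pmulr_rge0// subr_ge0.
Qed.

Lemma dotv_le_half n (x y : 'rV[R]_n) : dotv x y <= (dotv x x + dotv y y) / 2.
Proof.
have := dotv_ge0 (x - y); rewrite dotvBl !dotvBr (dotvC y x); lra.
Qed.

Lemma dotv_sumr n (T : finType) (F : T -> 'rV[R]_n) z :
  dotv z (\sum_i F i) = \sum_i dotv z (F i).
Proof. by rewrite dotvC dotv_suml; apply: eq_bigr => i _; rewrite dotvC. Qed.

End dotv.

Section determinants.

(** Sylvester's identity: one block matrix with unit diagonal blocks is factored into block
    triangular matrices in two ways. *)
Lemma det_1DmulC (R : comNzRingType) m n (X : 'M[R]_(m, n)) (Y : 'M[R]_(n, m)) :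
  \det (1%:M + X *m Y) = \det (1%:M + Y *m X).
Proof.
transitivity (\det (block_mx 1%:M (- X) Y 1%:M)).
  rewrite (_ : block_mx _ _ _ _ = block_mx (1%:M + X *m Y) (- X) 0 1%:M *m
      block_mx 1%:M 0 Y 1%:M).
    by rewrite det_mulmx det_ublock det_lblock !det1 !mulr1.
  rewrite mulmx_block !mulmx1 !mul1mx !mul0mx mulmx0 !add0r mulNmx.
  by rewrite addrK.
rewrite (_ : block_mx _ _ _ _ = block_mx 1%:M 0 Y 1%:M *m
    block_mx 1%:M (- X) 0 (1%:M + Y *m X)).
  by rewrite det_mulmx det_ublock det_lblock !det1 !mul1r.
rewrite mulmx_block !mulmx1 !mul1mx !mul0mx !addr0 ?mulmx0 ?addr0 mulmxN.
by rewrite addrCA addNr addr0.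
Qed.

Variable R : realType.

Lemma det_1Drank1 n (a b : 'rV[R]_n) : \det (1%:M + a^T *m b) = 1 + dotv a b.
Proof.
rewrite det_1DmulC (@det_mx11 R) mxE [in LHS]mxE eqxx mulr1n -dotvE dotvC//.
Qed.

(** The rows of [E] are orthonormal and the matrix equals [(1 + t) (1 - t / (1 + t) E^T E)];
    Sylvester's identity turns the second factor into a scalar [k] by [k] matrix. *)
Lemma det_1Dproj n k (E : 'M[R]_(k, n)) (t : R) : (k <= n)%N -> 0 <= t ->
  E *m E^T = 1%:M ->
  \det (1%:M + t *: (1%:M - E^T *m E)) = (1 + t) ^+ (n - k).
Proof.
move=> kn t0 EE; have t1 : 1 + t != 0 by rewrite gt_eqF// ltr_wpDr.
rewrite (_ : 1%:M + _ = (1 + t) *: (1%:M + ((- t / (1 + t)) *: E^T) *m E)).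
  rewrite detZ det_1DmulC -scalemxAr EE -[X in \det (X + _)]scale1r -scalerDl.
  rewrite detZ det1 mulr1 (_ : 1 + - t / (1 + t) = (1 + t)^-1); last by field.
  by rewrite exprVn exprB// unitfE.
rewrite [RHS]scalerDr -scalemxAl [X in _ = _ + X]scalerA mulrCA mulfV// mulr1.
by rewrite scaleNr scalerBr scalerDl scale1r addrA.
Qed.

(** With [P = 1 - E^T E] idempotent, [1 + t P] has inverse [1 - u P] for [u = t / (1 + t)].
    Factoring [1 + t P] out leaves a rank-one perturbation of the identity. *)
Lemma det_1Dpert n k (E : 'M[R]_(k, n)) (s : 'rV_n) (c t : R) :
  (k <= n)%N -> 0 <= t -> E *m E^T = 1%:M ->
  \det (1%:M + t *: (1%:M - E^T *m E + c *: (s^T *m s))) =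
  (1 + t) ^+ (n - k) *
  (1 + t * c * (dotv s s - t / (1 + t) * (dotv s s - dotv (s *m E^T) (s *m E^T)))).
Proof.
move=> kn t0 EE; have t1 : 1 + t != 0 by rewrite gt_eqF// ltr_wpDr.
set P := 1%:M - E^T *m E.
have PP : P *m P = P.
  rewrite /P mulmxBl mul1mx mulmxBr mulmx1 -mulmxA (mulmxA E) EE mul1mx.
  by rewrite subrr subr0.
set u := t / (1 + t).
have uE : t - u - t * u = 0 by rewrite /u; field.
have inv : (1%:M + t *: P) *m (1%:M - u *: P) = 1%:M.
  rewrite mulmxDl mul1mx mulmxBr mulmx1 -!scalemxAl -scalemxAr PP scalerA.
  rewrite -addrA [X in _ + X](_ : _ = (t - u - t * u) *: P).
    by rewrite uE scale0r addr0.
  by rewrite !scalerBl addrCA addrA.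
rewrite (_ : 1%:M + _ = (1%:M + t *: P) *m
    (1%:M + ((t * c) *: (s *m (1%:M - u *: P)))^T *m s)).
  rewrite det_mulmx det_1Dproj// det_1Drank1; congr (_ * (1 + _)).
  rewrite dotvZl; congr (_ * _); rewrite mulmxBr mulmx1 dotvBl -scalemxAr dotvZl.
  congr (_ - _ * _); rewrite /P mulmxBr mulmx1 dotvBl mulmxA.
  by rewrite [in RHS]dotv_mulmx trmxK dotvC.
have sym : (1%:M - u *: P)^T = 1%:M - u *: P.
  by rewrite linearB linearZ /= !linearB /= !trmx1 trmx_mul trmxK.
have trZ a (x : 'rV[R]_n) : (a *: x)^T = a *: x^T by apply/matrixP => i j; rewrite !mxE.
rewrite trZ trmx_mul sym mulmxDr mulmx1 -!scalemxAl -!scalemxAr.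
by rewrite mulmxA (mulmxA _ _ s^T) inv mul1mx scalerDr scalerA addrA.
Qed.

End determinants.

(** * Lebesgue measure on R^n *)

Section volume.
Variable R : realType.
Local Notation RR := (measurableTypeR R).
Local Notation leb := (@lebesgue_measure R).

Definition row_of_tuple n (t : n.-tuple RR) : 'rV[R]_n := \row_i tnth t i.

Definition measurable_rV n (A : set 'rV[R]_n) :=
  measurable (@row_of_tuple n @^-1` A).

Lemma measurable_rV_affine m n (M : 'M[R]_(m, n)) (b : 'rV_n) (A : set 'rV_n) :
  measurable_rV A -> measurable_rV [set x | A (x *m M + b)].
Proof.
pose f (t : m.-tuple RR) : n.-tuple RR :=
  [tuple (row_of_tuple t *m M + b) 0 i | i < n].
have mf : measurable_fun setT f.
  apply/measurable_fun_tnthP => i.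
  rewrite (_ : _ \o _ = fun t => \sum_j tnth t j * M j i + b 0 i).
    apply: measurable_funD => //; apply: measurable_sum => /= j.
    by apply: measurable_funM => //; exact: measurable_tnth.
  apply/funext => t /=; rewrite tnth_mktuple !mxE; congr (_ + _).
  by apply: eq_bigr => j _; rewrite mxE.
have fE t : row_of_tuple (f t) = row_of_tuple t *m M + b.
  by apply/rowP => i; rewrite mxE tnth_mktuple.
move=> mA; rewrite /measurable_rV.
have := mf measurableT _ mA; rewrite setTI; congr measurable.
by apply/seteqP; split=> t /=; rewrite fE.
Qed.

(** * Slicing and the affine change of variables *)

Definition row_cons n (x : R) (y : 'rV[R]_n) : 'rV[R]_n.+1 :=
  row_mx (x%:M : 'M[R]_1) y.

Lemma row_of_tuple_cons n (x : RR) (t : n.-tuple RR) :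
  row_of_tuple [tuple of x :: t] = row_cons x (row_of_tuple t).
Proof.
apply/rowP => i; rewrite !mxE; case: splitP => j ij.
  by rewrite ord1 mxE (_ : i = ord0)//; apply/val_inj; rewrite /= ij ord1.
rewrite mxE (_ : i = lift ord0 j) ?tnthS//.
exact/val_inj.
Qed.

Lemma volume_slice n (A : set 'rV[R]_n.+1) :
  volume A = (\int[leb]_x volume [set y : 'rV_n | A (row_cons x y)])%E.
Proof.
apply: eq_integral => x _ /=; congr lebesgue_tuple.
by apply/seteqP; split=> t; rewrite /xsection /= ?inE /= -row_of_tuple_cons.
Qed.

Lemma measurable_rV_pair n (A : set 'rV[R]_n.+1) : measurable_rV A ->
  measurable [set p : RR * n.-tuple RR | A (row_cons p.1 (row_of_tuple p.2))].
Proof.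
move=> mA; have := @measurable_tuple_of_pair R n measurableT _ mA.
rewrite setTI; congr measurable.
by apply/seteqP; split=> -[x t] /=; rewrite -row_of_tuple_cons.
Qed.

Lemma measurable_rV_slice n (A : set 'rV[R]_n.+1) x : measurable_rV A ->
  measurable_rV [set y : 'rV_n | A (row_cons x y)].
Proof.
move=> /measurable_rV_pair/(measurable_xsection x); congr measurable.
by apply/seteqP; split=> t; rewrite /xsection /= ?inE.
Qed.

Lemma measurable_volume_slice n (A : set 'rV[R]_n.+1) : measurable_rV A ->
  measurable_fun [set: RR] (fun x : RR => volume [set y : 'rV_n | A (row_cons x y)]).
Proof.
move=> /measurable_rV_pair/(measurable_fun_xsection (@lebesgue_tuple R n)).
congr measurable_fun; apply/funext => x /=; congr lebesgue_tuple.
by apply/seteqP; split=> t; rewrite /xsection /= ?inE.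
Qed.

(** Tonelli for sets, from uniqueness of the product measure on rectangles: the first coordinate is
    integrated innermost, as the shears of [volume_lshear] require. *)
Lemma volume_slice_swap n (A : set 'rV[R]_n.+1) : measurable_rV A ->
  volume A = (\int[@lebesgue_tuple R n]_t
    leb [set x | A (row_cons x (row_of_tuple t))])%E.
Proof.
move=> mA.
transitivity ((leb \x^ @lebesgue_tuple R n)%E
    [set p : RR * n.-tuple RR | A (row_cons p.1 (row_of_tuple p.2))]).
  rewrite -(@product_measure_unique _ _ _ _ R leb (@lebesgue_tuple R n)
    (leb \x^ @lebesgue_tuple R n)%E) //.
  - rewrite volume_slice; apply: eq_integral => x _ /=; congr lebesgue_tuple.
    by apply/seteqP; split=> t; rewrite /xsection /= ?inE.
  - move=> B C mB mC; exact: product_measure2E.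
  - exact: measurable_rV_pair.
apply: eq_integral => t _ /=; congr leb.
by apply/seteqP; split=> x; rewrite /ysection /= ?inE.
Qed.

Lemma measurable_affine (a c : R) :
  measurable_fun setT (fun x : RR => a * x + c : RR).
Proof. by apply: measurable_funD => //; apply: measurable_funM. Qed.

(** The pushforward of Lebesgue measure under [x |-> a x + c], scaled by [|a|], agrees with Lebesgue
    measure on half-open intervals, hence on all measurable sets. A negative [a] swaps the closed
    end. *)
Lemma lebesgue_measure_affine (a c : R) (B : set RR) : a != 0 -> measurable B ->
  leb [set x | B (a * x + c)] = (`|a|^-1%:E * leb B)%E.
Proof.
move=> a0 mB.
pose f (x : RR) : RR := a * x + c.
have mf : measurable_fun setT f by exact: measurable_affine.
have a0' : 0 <= `|a| by [].
pose mu : {measure set RR -> \bar R} :=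
  mscale (NngNum a0')
    (measure_function_pushforward__canonical__measure_function_Measure leb mf).
have -> : leb B = mu B.
  apply: lebesgue_measure_unique => // _ [[x y]] _ <-.
  rewrite /mu /= /mscale /= /pushforward.
  case: (ltgtP a 0) a0 => // a0 _.
  - rewrite (_ : f @^-1` _ = `[(y - c) / a, (x - c) / a[%classic).
      rewrite !lebesgue_measure_itv /= !lte_fin.
      rewrite ltr_nM2r ?invr_lt0// ltrD2r ltr0_norm//.
      case: ifPn => // _; last by rewrite mule0.
      by rewrite -!EFinD -EFinM; congr EFin; field; rewrite lt_eqF.
    apply/seteqP; split=> z /=; rewrite !in_itv /= /f.
      move=> /andP[h1 h2]; rewrite ler_ndivrMr// ltr_ndivlMr//; apply/andP; split; lra.
    move=> /andP[]; rewrite ler_ndivrMr// ltr_ndivlMr// => h1 h2; apply/andP; split; lra.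
  - rewrite (_ : f @^-1` _ = `](x - c) / a, (y - c) / a]%classic).
      rewrite !lebesgue_measure_itv /= !lte_fin.
      rewrite ltr_pM2r ?invr_gt0// ltrD2r gtr0_norm//.
      case: ifPn => // _; last by rewrite mule0.
      by rewrite -!EFinD -EFinM; congr EFin; field; rewrite gt_eqF.
    apply/seteqP; split=> z /=; rewrite !in_itv /= /f.
      move=> /andP[h1 h2]; rewrite ltr_pdivrMr// ler_pdivlMr//; apply/andP; split; lra.
    move=> /andP[]; rewrite ltr_pdivrMr// ler_pdivlMr// => h1 h2; apply/andP; split; lra.
by rewrite /mu /= /mscale /= muleA -EFinM mulVf ?normr_eq0// mul1e.
Qed.

Lemma integral_affine (a c : R) (f : RR -> \bar R) : a != 0 ->
  measurable_fun setT f -> (forall x, 0 <= f x)%E ->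
  (\int[leb]_x f (a * x + c)%R = `|a|^-1%:E * \int[leb]_x f x)%E.
Proof.
move=> a0 mf f0.
pose g (x : RR) : RR := a * x + c.
have mg : measurable_fun setT g by exact: measurable_affine.
have a0' : 0 <= `|a|^-1 by rewrite invr_ge0.
rewrite -(ge0_integral_mscale _ _ (NngNum a0'))//.
transitivity (\int[pushforward leb g]_x f x)%E.
  by rewrite ge0_integral_pushforward.
apply: eq_measure_integral => A mA _ /=.
exact: (lebesgue_measure_affine c a0 mA).
Qed.

Lemma row_cons_ublock n (a x : R) (r y b : 'rV[R]_n) (N : 'M[R]_n) (b0 : R) :
  row_cons x y *m (block_mx (a%:M : 'M[R]_1) r 0 N : 'M[R]_n.+1) + row_cons b0 b =
  row_cons (a * x + b0) (y *m N + (x *: r + b)).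
Proof.
rewrite /row_cons (@mul_row_block _ 1 1 n 1 n) mulmx0 addr0 (@add_row_mx _ 1 1 n).
rewrite -scalar_mxM -raddfD /= mul_scalar_mx [a * x]mulrC.
by rewrite addrCA addrA.
Qed.

(** The shear translates the first coordinate by an amount depending only on the others, so every
    inner one-dimensional measure is unchanged. *)
Lemma volume_lshear n (c : 'cV[R]_n) (A : set 'rV_n.+1) : measurable_rV A ->
  volume [set z | A (z *m (block_mx (1%:M : 'M[R]_1) 0 c 1%:M : 'M[R]_n.+1))] =
  volume A.
Proof.
move=> mA; rewrite !volume_slice_swap//; last first.
  have := measurable_rV_affine (block_mx (1%:M : 'M[R]_1) 0 c 1%:M : 'M[R]_n.+1) 0 mA.
  by congr measurable_rV; apply/seteqP; split=> z; rewrite /= addr0.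
apply: eq_integral => t _.
have mAt : measurable [set x : RR | A (row_cons x (row_of_tuple t))].
  have /(measurable_ysection t) := measurable_rV_pair mA.
  by congr measurable; apply/seteqP; split=> x; rewrite /ysection /= ?inE.
have := lebesgue_measure_affine ((row_of_tuple t *m c) 0 0) (oner_neq0 R) mAt.
rewrite normr1 invr1 mul1e => <-; congr leb.
apply/seteqP; split=> x; rewrite /= /row_cons (@mul_row_block _ 1 1 n 1 n);
  rewrite mulmx0 add0r !mulmx1 mul1r [X in row_mx (_ + X) _]mx11_scalar;
  by rewrite -raddfD.
Qed.

(** The slice over [x] is an affine preimage, with matrix [N], of the slice over [a x + b0];
    substitution in the outer integral gives [|a|^-1]. The induction in [volume_affine] supplies the
    scaling law of [N]. *)
Lemma volume_ublock n (a : R) (r : 'rV[R]_n) (N : 'M[R]_n) (b : 'rV[R]_n.+1)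
    (k : R) (A : set 'rV_n.+1) : a != 0 -> 0 <= k ->
  (forall (b' : 'rV_n) (B : set 'rV_n), measurable_rV B ->
     volume [set x | B (x *m N + b')] = (k%:E * volume B)%E) ->
  measurable_rV A ->
  volume [set z | A (z *m (block_mx (a%:M : 'M[R]_1) r 0 N : 'M[R]_n.+1) + b)] =
  ((`|a|^-1 * k)%:E * volume A)%E.
Proof.
move=> a0 k0 IH mA.
rewrite -[b](@hsubmxK _ 1 1 n).
set b0 := lsubmx _; set b1 := rsubmx _; rewrite [b0]mx11_scalar.
pose F (x : RR) := volume [set y : 'rV_n | A (row_cons x y)].
rewrite volume_slice; transitivity (\int[leb]_x (k%:E * F (a * x + b0 0 0)%R))%E.
  apply: eq_integral => x _.
  have := IH (x *: r + b1) _ (measurable_rV_slice (a * x + b0 0 0) mA).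
  rewrite /F => <-; congr volume; apply/seteqP.
  by split=> y /=; rewrite -row_cons_ublock.
have mF : measurable_fun setT F by exact: measurable_volume_slice.
have F0 x : (0 <= F x)%E by exact: measure_ge0.
rewrite ge0_integralZl//; last first.
  exact: (measurableT_comp mF (measurable_affine _ _)).
by rewrite integral_affine// -volume_slice muleA -EFinM mulrC.
Qed.

(** Induction on the dimension. If the corner entry is nonzero, one step of Gaussian elimination
    factors the matrix as a lower shear times a block upper triangular matrix; a zero corner is
    first repaired by adding another row, which keeps the determinant. *)
Lemma volume_affine n (M : 'M[R]_n) (b : 'rV[R]_n) (A : set 'rV[R]_n) :
  \det M != 0 -> measurable_rV A ->
  volume [set x | A (x *m M + b)] = (`|\det M|^-1%:E * volume A)%E.
Proof.
elim: n M b A => [|n IH] M b A.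
  move=> _ mA; rewrite det_mx00 normr1 invr1 mul1e; congr volume.
  by apply/seteqP; split=> x /=; rewrite [_ + b]thinmx0 [x]thinmx0.
have pivot (M' : 'M[R]_n.+1) (b' : 'rV_n.+1) : \det M' != 0 -> M' 0 0 != 0 ->
    measurable_rV A ->
    volume [set x | A (x *m M' + b')] = (`|\det M'|^-1%:E * volume A)%E.
  move=> dM' a0 mA.
  pose a := M' 0 0; pose r : 'rV[R]_n := @ursubmx _ 1 n 1 n M'.
  pose c : 'cV[R]_n := @dlsubmx _ 1 n 1 n M'.
  pose N : 'M[R]_n := @drsubmx _ 1 n 1 n M' - a^-1 *: (c *m r).
  have M'E : M' = (block_mx (1%:M : 'M[R]_1) 0 (a^-1 *: c) 1%:M : 'M[R]_(1 + n)) *m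
                  (block_mx (a%:M : 'M[R]_1) r 0 N : 'M[R]_(1 + n)).
    rewrite (@mulmx_block _ 1 n 1 n 1 n) !mul1mx !mul0mx ?mulmx0 !addr0.
    rewrite mul_mx_scalar scalerA mulfV// scale1r -scalemxAl /N addrC subrK.
    have <- : @ulsubmx _ 1 n 1 n M' = a%:M.
      rewrite [LHS]mx11_scalar !mxE; congr (M' _ _)%:M; exact/val_inj.
    exact/esym/(@submxK _ 1 n 1 n).
  have dE : \det M' = a * \det N.
    rewrite M'E det_mulmx (@det_lblock _ 1 n) (@det_ublock _ 1 n).
    by rewrite !det1 !mul1r det_scalar1.
  have dN : \det N != 0 by move: dM'; rewrite dE mulf_eq0 negb_or => /andP[].
  pose lo : 'M[R]_n.+1 := block_mx (1%:M : 'M[R]_1) 0 (a^-1 *: c) 1%:M.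
  pose up : 'M[R]_n.+1 := block_mx (a%:M : 'M[R]_1) r 0 N.
  pose S := [set z | A (z *m up + b')].
  rewrite (_ : [set x | _] = [set z | S (z *m lo)]).
    rewrite volume_lshear; last exact: measurable_rV_affine.
    rewrite (volume_ublock r b' a0 (k := `|\det N|^-1))//.
      by rewrite dE normrM invfM.
    by move=> b'' B mB; exact: IH.
  by apply/seteqP; split=> x; rewrite /S /= {1}M'E mulmxA.
move=> dM mA; have [M00|M00] := eqVneq (M 0 0) 0; last exact: pivot.
have [i Mi0] : exists i : 'I_n, M (lift ord0 i) 0 != 0.
  apply/not_existsP => M0; case/eqP: dM.
  rewrite -det_tr (expand_det_row _ 0) big1// => i _; rewrite mxE.
  case: (unliftP ord0 i) => [j ->|->]; last by rewrite M00 mul0r.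
  by have /negP/negPn/eqP -> := M0 j; rewrite mul0r.
pose E : 'M[R]_n.+1 := block_mx (1%:M : 'M[R]_1) (delta_mx 0 i) 0 1%:M.
have dE : \det E = 1 by rewrite /E (@det_ublock _ 1 n) !det1 mul1r.
pose S := [set x | A (x *m M + b)].
have mS : measurable_rV S by exact: measurable_rV_affine.
have := @volume_ublock n 1 (delta_mx 0 i) 1%:M 0 1 S (oner_neq0 _) ler01.
rewrite -/E normr1 invr1 mul1r mul1e => <-//; last first.
  move=> b' B mB; have := IH 1%:M b' B; rewrite det1 normr1 invr1 mul1e.
  by apply; rewrite ?oner_neq0.
rewrite (_ : [set z | _] = [set x | A (x *m (E *m M) + b)]).
  rewrite pivot ?det_mulmx ?dE ?mul1r//.
  rewrite /E -[M](@submxK _ 1 n 1 n) (@mulmx_block _ 1 n 1 n 1 n).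
  have -> : (0 : 'I_n.+1) = lshift n (0 : 'I_1) by exact/val_inj.
  rewrite (@block_mxEul _ 1 n 1 n) mxE mul1mx -rowE !mxE.
  have -> : lshift n (0 : 'I_1) = 0 :> 'I_n.+1 by exact/val_inj.
  by rewrite M00 add0r (_ : rshift 1 i = lift ord0 i)//; exact/val_inj.
by apply/seteqP; split=> x; rewrite /S /= addr0 mulmxA.
Qed.

(** If [w] has a nonzero tail, each slice is a hyperplane one dimension lower. Otherwise only the
    slice at [c / w 0 0] is nonempty, and a point is a null set. *)
Lemma volume_hyperplane n (w : 'rV[R]_n) (c : R) : w != 0 ->
  volume [set x | dotv x w = c] = 0%E.
Proof.
elim: n w c => [|n IH] w c w0; first by rewrite [w]thinmx0 eqxx in w0.
have dotE x (y : 'rV_n) : dotv (row_cons x y) w = x * w 0 0 + dotv y (@rsubmx _ 1 1 n w).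
  rewrite /dotv big_ord_recl; congr (_ * _ + _).
    rewrite mxE; case: splitP => // j _; by rewrite ord1 mxE eqxx mulr1n.
  apply: eq_bigr => i _; rewrite !mxE; case: splitP => [j|j /= ij].
    by rewrite ord1.
  by congr (y 0 _ * w 0 _); apply/val_inj => //=; move: ij => [].
rewrite volume_slice.
have [w1|w1] := eqVneq (@rsubmx _ 1 1 n w) 0; last first.
  apply: integral0_eq => x _; rewrite -[RHS](IH _ (c - x * w 0 0) w1).
  congr volume; apply/seteqP; split=> y /=; rewrite dotE; first by move=> <-; ring.
  by move=> ->; ring.
have w00 : w 0 0 != 0.
  apply: contra_neq w0 => w00; rewrite -[w](@hsubmxK _ 1 1 n) w1.
  rewrite [@lsubmx _ 1 1 n w]mx11_scalar !mxE.
  rewrite (_ : lshift n (0 : 'I_1) = 0); last exact/val_inj.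
  by rewrite w00 raddf0 row_mx0.
transitivity (\int[leb]_x (@volume R n setT * (\1_[set c / w 0 0] x)%:E))%E.
  apply: eq_integral => x _; rewrite indicE.
  have xE : (x \in [set c / w 0 0]) = (x * w 0 0 == c).
    by rewrite (can2_eq (mulfK w00) (mulfVK w00)) in_set1.
  rewrite xE; have [xc|xc] := eqVneq (x * w 0 0) c; rewrite ?mule1 ?mule0.
    congr volume; apply/seteqP; split=> y //= _; rewrite dotE w1 xc /dotv.
    by rewrite big1 ?addr0// => i _; rewrite mxE mulr0.
  rewrite -[RHS](measure0 (@lebesgue_tuple R n)); congr lebesgue_tuple.
  apply/seteqP; split=> y //=; rewrite dotE w1 /dotv big1 ?addr0.
    by move=> /eqP; rewrite (negbTE xc).
  by move=> i _; rewrite !mxE mulr0.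
rewrite ge0_integralZl//; last first.
  by apply/measurable_EFinP; exact: measurable_indic.
by rewrite integral_indic// setIT [X in (_ * X)%E]lebesgue_measure_set1 mule0.
Qed.

(** * Volume of the simplex *)

Lemma integral_sub_exp n (s : R) : 0 < s ->
  (\int[leb]_(x in `[0%R, s]%classic) ((s - x) ^+ n)%R%:E = (s ^+ n.+1 / n.+1%:R)%R%:E)%E.
Proof.
move=> s0.
pose p : {poly R} := (s%:P - 'X) ^+ n.
pose q : {poly R} := (- n.+1%:R^-1) *: (s%:P - 'X) ^+ n.+1.
have qp : q^`() = p.
  rewrite /q derivZ deriv_exp derivB derivC derivX sub0r /= mulN1r mulNrn.
  rewrite scalerN scaleNr opprK -[X in _ *: X]scaler_nat scalerA.
  by rewrite mulVf ?pnatr_eq0// scale1r.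
have cq (r : {poly R}) : continuous (horner r).
  move=> x; apply: differentiable_continuous; apply/derivable1_diffP.
  exact: (@ex_derive _ _ _ _ _ _ _ (is_derive_poly r x)).
have := @continuous_FTC2 _ (horner p) (horner q) 0 s s0.
have pE x : p.[x] = (s - x) ^+ n by rewrite /p !hornerE.
have qE x : q.[x] = - n.+1%:R^-1 * (s - x) ^+ n.+1 by rewrite /q !hornerE.
rewrite !qE subrr expr0n mulr0 sub0e -EFinN -mulNr opprK subr0 mulrC => <-.
- by apply: eq_integral => x _; rewrite pE.
- exact/continuous_subspaceT/cq.
- split; [|exact/cvg_at_right_filter/cq|exact/cvg_at_left_filter/cq].
  move=> x _; exact: (@ex_derive _ _ _ _ _ _ _ (is_derive_poly q x)).
- move=> x _; rewrite derive1E (@derive_val _ _ _ _ _ _ _ (is_derive_poly q x)).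
  by rewrite qp.
Qed.

Definition simplex n (s : R) : set 'rV[R]_n :=
  [set y | (forall i, 0 <= y 0 i) /\ \sum_i y 0 i <= s].

Lemma volume_simplex n (s : R) : 0 <= s ->
  volume (@simplex n s) = (s ^+ n / n`!%:R)%:E.
Proof.
elim: n s => [|n IH] s s0.
  rewrite expr0 fact0 invr1 mulr1 /volume /= diracE mem_set// /simplex /=.
  by rewrite big_ord0; split => // -[].
have slice x : [set y : 'rV_n | @simplex n.+1 s (row_cons x y)] =
    [set y | 0 <= x /\ @simplex n (s - x) y].
  have c0 (y : 'rV[R]_n) : row_cons x y 0 ord0 = x.
    by rewrite mxE; case: splitP => // j _; rewrite ord1 mxE eqxx mulr1n.
  have cS (y : 'rV[R]_n) i : row_cons x y 0 (lift ord0 i) = y 0 i.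
    rewrite mxE; case: splitP => [j|j [] ij]; first by rewrite ord1.
    by congr (y 0 _); exact/val_inj.
  apply/seteqP; split=> y; rewrite /simplex /= big_ord_recl c0 lerBrDl.
    move=> [h1 h2]; split; first by have := h1 ord0; rewrite c0.
    split=> [i|]; first by have := h1 (lift ord0 i); rewrite cS.
    by under eq_bigr do rewrite -cS.
  move=> [x0 [h1 h2]]; split; last by under eq_bigr do rewrite cS.
  by move=> i; case: (unliftP ord0 i) => [j|] ->; rewrite ?c0 ?cS.
rewrite volume_slice.
under eq_integral do rewrite slice.
transitivity (\int[leb]_(x in `[0%R, s]%classic) (n`!%:R^-1%:E * ((s - x) ^+ n)%R%:E))%E.
  rewrite [RHS]integral_mkcond; apply: eq_integral => x _.
  rewrite patchE; case: ifPn => [|/negP] xs.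
    move: xs; rewrite inE /= in_itv /= => /andP[x0 xs].
    rewrite (_ : [set y | _] = @simplex n (s - x)) ?IH ?subr_ge0//.
      by rewrite -EFinM mulrC.
    by apply/seteqP; split=> y // [].
  rewrite -[RHS](measure0 (@lebesgue_tuple R n)); congr lebesgue_tuple.
  apply/seteqP; split=> t //= -[x0 [h1 h2]]; apply: xs; rewrite inE /= in_itv /=.
  by rewrite x0 -subr_ge0 (le_trans _ h2)// sumr_ge0.
have [->|sn0] := eqVneq s 0.
  by rewrite set_itv1 integral_set1 expr0n /= mul0r.
rewrite ge0_integralZl//=.
- rewrite integral_sub_exp ?lt_neqAle 1?eq_sym ?sn0// -EFinM factS natrM invfM.
  by rewrite mulrC -mulrA.
- by apply/measurable_EFinP/measurable_funX/measurable_funB.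
- move=> x; rewrite /= in_itv /= => /andP[x0 xs].
  by rewrite lee_fin exprn_ge0 ?subr_ge0.
Qed.

(** * Measurability and nondegeneracy of intersections of half-spaces *)

Lemma measurable_rV_halfspace n (w : 'rV[R]_n) (c : R) :
  measurable_rV [set x | dotv x w < c].
Proof.
pose f (t : n.-tuple RR) : RR := dotv (row_of_tuple t) w.
have mf : measurable_fun setT f.
  rewrite (_ : f = fun t => \sum_i tnth t i * w 0 i).
    apply: measurable_sum => /= j.
    by apply: measurable_funM => //; exact: measurable_tnth.
  by apply/funext => t; apply: eq_bigr => i _; rewrite mxE.
have := mf measurableT _ (measurable_itv `]-oo, c[); rewrite setTI.
by congr measurable; apply/seteqP; split => t; rewrite /f /= in_itv.
Qed.

Lemma measurable_rV_coord n (D : 'I_n -> set RR) :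
  (forall i, measurable (D i)) -> measurable_rV [set x | forall i, D i (x 0 i)].
Proof.
move=> mD; rewrite /measurable_rV (_ : _ @^-1` _ = \bigcap_(i in [set: 'I_n])
    ((@tnth n RR ^~ i) @^-1` D i)).
  apply: fin_bigcap_measurable => // i _.
  by rewrite -[X in measurable X]setTI; exact: measurable_tnth.
by apply/seteqP; split => t /= H i; have := H i; rewrite mxE; exact.
Qed.

(** The family may be uncountable, so measurability comes from openness of the complement: it is the
    countable union of the rational boxes that it contains. *)
Lemma measurable_rV_bigcap_halfspace n (I : Type) (v : I -> 'rV[R]_n) :
  measurable_rV (\bigcap_(i : I) halfspace (v i)).
Proof.
set P := \bigcap_(i : I) _.
pose box (p : 'rV[rat]_n * 'rV[rat]_n) : set 'rV[R]_n :=
  [set x | forall i, ratr (p.1 0 i) < x 0 i < ratr (p.2 0 i)].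
have mbox p : measurable_rV (box p).
  pose D i : set RR := `](ratr (p.1 0 i)), (ratr (p.2 0 i))[%classic.
  rewrite (_ : box p = [set x | forall i, D i (x 0 i)]).
    by apply: measurable_rV_coord => i; exact: measurable_itv.
  by apply/seteqP; split=> x /= + i => /(_ i); rewrite /D /= in_itv.
suff : measurable_rV (~` P).
  move=> /measurableC; congr measurable.
  by apply/seteqP; split=> x /=; rewrite ?notK// => /contrapT.
pose F p : set (n.-tuple RR) :=
  [set t | box p `<=` ~` P /\ box p (row_of_tuple t)].
rewrite /measurable_rV (_ : _ @^-1` _ = \bigcup_p F p).
  apply: countable_bigcupT_measurable; first exact: countableP.
  move=> p; have [pP|pP] := pselect (box p `<=` ~` P).
    by have := mbox p; congr measurable; apply/seteqP; split=> t // [].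
  by rewrite (_ : F p = set0)//; apply/seteqP; split=> t // [].
apply/seteqP; split=> t; last by move=> [p _ [pP /pP]].
move=> /existsNP[i] /not_implyP[_ /negP]; set x := row_of_tuple t; rewrite -ltNge => xv.
(* [L] exceeds the l1-norm of the normal, so moving each coordinate by at most [d] changes the
   linear form by less than its excess over 1. *)
pose L := 1 + \sum_k `|v i 0 k|.
have L0 : 0 < L by rewrite ltr_pwDl// sumr_ge0.
pose d := (dotv x (v i) - 1) / L.
have d0 : 0 < d by rewrite divr_gt0// subr_gt0.
have /choice[a aP] k : exists a : rat, ratr a \in `](x 0 k - d), (x 0 k)[.
  by apply: rat_in_itvoo; rewrite gtrBl.
have /choice[b bP] k : exists b : rat, ratr b \in `](x 0 k), (x 0 k + d)[.
  by apply: rat_in_itvoo; rewrite ltrDl.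
exists (\row_k a k, \row_k b k) => //; split; last first.
  move=> k; move: (aP k) (bP k); rewrite !in_itv /= !mxE.
  by move=> /andP[_ ->] /andP[->].
move=> y yb /(_ i Logic.I); rewrite /halfspace /=; apply/negP; rewrite -ltNge.
have yx k : `|y 0 k - x 0 k| <= d.
  move: (yb k) (aP k) (bP k); rewrite !in_itv /= !mxE.
  move=> /andP[h1 h2] /andP[h3 h4] /andP[h5 h6].
  by rewrite ler_norml; apply/andP; split; lra.
have : dotv x (v i) - dotv y (v i) <= d * \sum_k `|v i 0 k|.
  rewrite -sumrB mulr_sumr ler_sum// => k _; rewrite -mulrBl.
  by rewrite (le_trans (ler_norm _))// normrM distrC ler_wpM2r.
have : d * L = dotv x (v i) - 1 by rewrite mulfVK// gt_eqF.
rewrite /L mulrDr mulr1; lra.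
Qed.

Lemma le_volume n (A B : set 'rV[R]_n) : measurable_rV A -> measurable_rV B ->
  A `<=` B -> (volume A <= volume B)%E.
Proof. by move=> mA mB AB; apply: le_measure; rewrite ?inE// => t; exact: AB. Qed.

Lemma measurable_rV_polar n (V : set 'rV[R]_n) :
  measurable_rV [set x | forall v, V v -> dotv x v <= 1].
Proof.
have := measurable_rV_bigcap_halfspace (fun v : {v : 'rV[R]_n | V v} => sval v).
congr measurable_rV; apply/seteqP; split=> x /= xV.
  by move=> v Vv; exact: (xV (exist _ v Vv)).
by move=> [v Vv] _; exact: xV.
Qed.

Lemma measurable_rV_ge n (w : 'rV[R]_n) (c : R) :
  measurable_rV [set x | c <= dotv x w].
Proof.
have /measurableC := measurable_rV_halfspace w c; congr measurable.
by apply/seteqP; split=> x /=; rewrite leNgt => /negP.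
Qed.

Lemma measurable_rV_simplex n (t : R) : measurable_rV (@simplex n t).
Proof.
rewrite /measurable_rV (_ : _ @^-1` _ = \bigcap_(i in [set: 'I_n])
      (@row_of_tuple n @^-1` [set y | 0 <= dotv y (delta_mx 0 i)]) `&`
    (@row_of_tuple n @^-1` [set y | - t <= dotv y (const_mx (-1))])).
  apply: measurableI; last exact: measurable_rV_ge.
  by apply: fin_bigcap_measurable => // i _; exact: measurable_rV_ge.
have dE y i : dotv y (delta_mx 0 i) = y 0 i :> R.
  rewrite /dotv (bigD1 i)//= mxE !eqxx mulr1 big1 ?addr0// => l li.
  by rewrite mxE (negbTE li) andbF mulr0.
have cE (y : 'rV[R]_n) : dotv y (const_mx (-1)) = - \sum_i y 0 i.
  by rewrite -sumrN; apply: eq_bigr => l _; rewrite mxE mulrN1.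
apply/seteqP; split=> y /=; rewrite cE lerN2 => -[h1 h2]; split => // i.
  by move=> _ /=; rewrite dE.
by have /= := h1 i Logic.I; rewrite dE.
Qed.

(** Choose differences [x - x0], with [x] in [P], of the largest possible rank. If that rank were
    below [n], [P] would lie in a hyperplane and have volume 0. *)
Lemma volume_gt0_span n (P : set 'rV[R]_n) : measurable_rV P -> (0 < volume P)%E ->
  exists (x0 : 'rV[R]_n) (A : 'M[R]_n),
    [/\ \det A != 0, P x0 & forall i, P (x0 + row i A)].
Proof.
move=> mP P0.
have [x0 Px0] : exists x0, P x0.
  apply/not_existsP => noP; move: P0; rewrite (_ : P = set0).
    by rewrite /volume (_ : [set _ | _] = set0) ?measure0 ?ltxx//.
  by apply/seteqP; split=> x // Px; have := noP x.
pose S k := `[< exists m (X : 'M[R]_(m, n)),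
  (forall i, P (x0 + row i X)) /\ \rank X = k >].
have S0 : exists k, S k.
  by exists 0%N; apply/asboolP; exists 0%N, 0; split=> [[]//|]; rewrite mxrank0.
have Sn k : S k -> (k <= n)%N by move=> /asboolP[m [X [_ <-]]]; exact: rank_leq_col.
have [r /asboolP[m [X [PX rX]]] rmax] := ex_maxnP S0 Sn.
have [rn|rn] := ltnP r n.
  exfalso.
  have span x : P x -> (x - x0 <= X)%MS.
    move=> Px.
    have : S (\rank (col_mx X (x - x0))).
      apply/asboolP; exists (m + 1)%N, (col_mx X (x - x0)); split => // i.
      case: (split_ordP i) => j ->; first by rewrite rowKu.
      rewrite rowKd (_ : row j (x - x0) = x - x0) ?subrKC//.
      by apply/rowP => l; rewrite mxE (ord1 j).
    move=> /rmax; rewrite -rX => h.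
    have sub : (X <= col_mx X (x - x0))%MS by rewrite -addsmxE addsmxSl.
    have := (mxrank_leqif_sup sub).2.
    rewrite eqn_leq mxrankS//= h => /esym.
    by rewrite col_mx_sub submx_refl.
  have : kermx X^T != 0.
    by rewrite -mxrank_eq0 mxrank_ker subn_eq0 -ltnNge mxrank_tr rX.
  move=> /rowV0Pn[w /sub_kermxP wX w0].
  have Psub : P `<=` [set x | dotv x w = dotv x0 w].
    move=> x /span/submxP[y xy] /=; apply/eqP; rewrite -subr_eq0 -dotvBl xy.
    by rewrite dotv_mulmx wX dotv0r.
  move: P0; apply/negP; rewrite -leNgt -(volume_hyperplane (dotv x0 w) w0).
  apply: le_volume => //.
  rewrite /measurable_rV (_ : _ @^-1` _ =
    (@row_of_tuple n @^-1` [set y | dotv x0 w <= dotv y w]) `&`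
    (@row_of_tuple n @^-1` [set y | - dotv x0 w <= dotv y (- w)])).
    by apply: measurableI; exact: measurable_rV_ge.
  apply/seteqP; split=> t /=; rewrite dotvNr lerN2; first by move=> ->; rewrite !lexx.
  by move=> [h1 h2]; apply/eqP; rewrite eq_le h1 h2.
have fX : row_full X by rewrite /row_full rX eqn_leq Sn ?rn//; apply/asboolP; exists m, X.
exists x0, (rowsub (fullrankfun fX) X); split => //.
  by rewrite -unitfE -unitmxE fullrowsub_unit.
by move=> i; rewrite row_rowsub.
Qed.

End volume.

(** * Approximate John position *)

Section near_john.
Variable R : realType.

Lemma bernoulli_ge m (t : R) : 0 <= t -> 1 + m%:R * t <= (1 + t) ^+ m.
Proof.
move=> t0; elim: m => [|m IH]; first by rewrite mul0r addr0 expr0.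
rewrite exprS; apply: le_trans (ler_wpM2l _ IH); last lra.
rewrite -natr1; have : 0 <= m%:R * t * t by rewrite !mulr_ge0.
nra.
Qed.

Lemma bernoulli_le m (a : R) : 0 <= 1 + a -> m%:R * a <= 1 ->
  (1 + a) ^+ m <= 1 + m%:R * a + (m%:R * a) ^+ 2.
Proof.
move=> a1; elim: m => [|m IH]; first by rewrite mul0r expr0; lra.
rewrite -natr1 => ma1.
have m0 : 0 <= m%:R :> R by [].
have ma : m%:R * a <= 1.
  have [a0|/ltW a0] := leP 0 a; first by lra.
  by rewrite (@le_trans _ _ 0)// mulr_ge0_le0.
rewrite exprS; apply: le_trans (ler_wpM2l a1 (IH ma)) _.
set M : R := m%:R in m0 ma *.
rewrite -subr_ge0 (_ : _ - _ = a ^+ 2 * (M * (1 - M * a) + 1)); last ring.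
by rewrite mulr_ge0 ?sqr_ge0// addr_ge0// mulr_ge0// subr_ge0.
Qed.

(** The map [y |-> z + y A] multiplies volume by [|det A|]: no ellipsoid in the polar body of [V]
    has more than [1 + e] times the volume of the unit ball. That the ball lies in the body is
    stated separately, as [dotv v v <= 1]. *)
Definition near_john n (V : set 'rV[R]_n) (e : R) :=
  forall (A : 'M[R]_n) (z : 'rV_n),
    (forall v y, V v -> dotv y y <= 1 -> dotv (z + y *m A) v <= 1) ->
    `|\det A| <= 1 + e.

(* With S = 1 - E^T E + c s^T s, the left-hand side is tr S / n and the right-hand
   side <Sv, v> + <b, v>. *)
Definition john_test n (V : set 'rV[R]_n) (L eta : R) :=
  forall k (E : 'M[R]_(k, n)) s b c,
    (k <= n)%N -> E *m E^T = 1%:M -> dotv s s <= L -> `|c| <= L ->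
  exists2 v, V v & ((n - k)%:R + c * dotv s s) / n%:R - eta <=
    dotv v v - dotv (v *m E^T) (v *m E^T) + c * dotv s v ^+ 2 + dotv b v.

(* Second-order estimates: X stands for the determinant of the rank-one part of
   the perturbation, q for its trace and t for the size of the perturbation. *)
Lemma near_john_scale n (L eta : R) (C := 2 + 2 * L ^+ 4) :
  (0 < n)%N -> 0 <= L -> 0 < eta ->
  exists2 t : R, 0 < t & forall m q X lam : R,
    0 <= m <= n%:R -> `|q| <= L ^+ 2 -> `|X - 1 - t * q| <= t ^+ 2 * L ^+ 2 ->
    lam = 1 + (t * ((m + q) / n%:R - eta) + t ^+ 2 * C) ->
    [/\ 0 < lam, 0 <= X & (1 + t ^+ 2 / 3) * lam ^+ n < (1 + m * t) * X].
Proof.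
move=> n0 L0 eta0; have N1 : 1 <= n%:R :> R by rewrite ler1n.
have L20 : 0 <= L ^+ 2 by rewrite sqr_ge0.
have C0 : 0 <= C by rewrite /C; have := exprn_ge0 4 L0; lra.
have CL : 2 * L ^+ 2 <= L ^+ 2 + C.
  by rewrite /C; have := sqr_ge0 (L ^+ 2 - 1); lra.
move: C C0 CL => C C0 CL.
(* [t B] will bound [|a|], while [t^2 D] and [t^2 G] will bound the second-order losses in
   [(1 + m t) X] and [lam ^+ n]. *)
have [B BE] : exists B, B = 1 + L ^+ 2 + eta + C by eexists.
have [D DE] : exists D, D = (1 + 2 * n%:R) * L ^+ 2 by eexists.
have [G GE] : exists G, G = n%:R * C + n%:R ^+ 2 * B ^+ 2 by eexists.
have B1 : 1 <= B by lra.
have D0 : 0 <= D by rewrite DE mulr_ge0//; lra.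
have G0 : 0 <= G by rewrite GE; apply: addr_ge0; apply: mulr_ge0; rewrite ?sqr_ge0.
have nB : 0 <= n%:R * B by rewrite mulr_ge0//; lra.
have [t [t0 t1 t2]] : exists t : R,
    [/\ 0 < t, t * (1 + n%:R * B) <= 1 & t * (D + G + 1) < eta].
  (* [t = eta / K] meets both bounds because [K] exceeds both [eta * (1 + n B)] and [D + G + 1]. *)
  have [K KE] : exists K, K = eta * (1 + n%:R * B) + (D + G + 1) by eexists.
  have K0 : 0 < K by rewrite KE ltr_pwDl ?mulr_gt0//; lra.
  exists (eta / K); split; first by rewrite divr_gt0.
    rewrite mulrAC ler_pdivrMr// mul1r KE; lra.
  rewrite mulrAC ltr_pdivrMr// ltr_pM2l// KE.
  have : 0 < eta * (1 + n%:R * B) by rewrite mulr_gt0//; lra.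
  lra.
have tB : t * (n%:R * B) < 1 by move: t1; rewrite mulrDr; lra.
have tB' : t * B < 1.
  by apply: le_lt_trans tB; rewrite ler_pM2l// ler_peMl//; lra.
have tt1 : t <= 1 by apply: le_trans (ltW tB'); rewrite ler_peMr// ltW.
exists t => // m q X lam /andP[m0 mn] qL XE lamE.
have [tau tauE] : exists tau, tau = (m + q) / n%:R by eexists.
have nt : n%:R * tau = m + q by rewrite tauE mulrC mulfVK// gt_eqF//; lra.
have [a aE] : exists a, a = t * (tau - eta) + t ^+ 2 * C by eexists.
rewrite -tauE -aE in lamE.
have tauL : `|tau| <= 1 + L ^+ 2.
  rewrite tauE mulrDl; apply: le_trans (ler_normD _ _) _; rewrite !normrM normfV.
  rewrite (ger0_norm (ler0n _ n)) (ger0_norm m0); apply: lerD.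
    by rewrite ler_pdivrMr ?mul1r//; lra.
  rewrite ler_pdivrMr; last lra.
  by apply: le_trans qL _; rewrite ler_peMr.
move: qL XE; rewrite !ler_norml => /andP[q1 q2] /andP[XE _].
have aB : `|a| <= t * B.
  rewrite aE expr2 -mulrA -mulrDr normrM (gtr0_norm t0) ler_pM2l//.
  have tC : 0 <= t * C <= C by rewrite mulr_ge0 ?(ltW t0)//= ler_piMl.
  move: tauL; rewrite !ler_norml => /andP[? ?].
  by apply/andP; split; rewrite BE; lra.
have lam0 : 0 < lam.
  by move: aB; rewrite ler_norml lamE => /andP[? ?]; lra.
have tq : - (t * L ^+ 2) <= t * q by rewrite -mulrN ler_pM2l.
have ttL : t * (t * L ^+ 2) <= t * L ^+ 2 by rewrite ler_pM2l// ler_piMl.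
have X0 : 0 <= X.
  have : t * (2 * L ^+ 2) <= t * B by rewrite ler_pM2l// BE; lra.
  lra.
split=> //.
have lower : 1 + t * (n%:R * tau) - t ^+ 2 * D <= (1 + m * t) * X.
  have mt0 : 0 <= m * t by rewrite mulr_ge0// ltW.
  have tL0 : 0 <= t * L ^+ 2 by rewrite mulr_ge0// ltW.
  have h1 : m * (t * L ^+ 2) <= n%:R * (t * L ^+ 2) by rewrite ler_wpM2r.
  have h2 : m * t * (1 + t * q - t ^+ 2 * L ^+ 2) <= m * t * X.
    by rewrite ler_wpM2l//; lra.
  have h3 : m * t * - (t * L ^+ 2) <= m * t * (t * q) by rewrite ler_wpM2l.
  have h4 : m * t * (t * (t * L ^+ 2)) <= m * t * (t * L ^+ 2) by rewrite ler_wpM2l.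
  have h5 : m * t * (t * L ^+ 2) <= n%:R * t * (t * L ^+ 2).
    by rewrite ler_wpM2r// ler_pM2r.
  rewrite nt DE; lra.
have aB2 : (n%:R * a) ^+ 2 <= n%:R ^+ 2 * (t ^+ 2 * B ^+ 2).
  rewrite exprMn ler_pM2l; last by rewrite exprn_gt0//; lra.
  rewrite -exprMn -[leLHS]real_normK ?num_real// lerXn2r// nnegrE.
  by rewrite (le_trans _ aB).
have na1 : n%:R * a <= 1.
  apply: le_trans (ltW tB); rewrite mulrCA ler_pM2l; last lra.
  by rewrite (le_trans (ler_norm _)).
have upper : lam ^+ n <= 1 + n%:R * a + (n%:R * a) ^+ 2.
  by rewrite lamE; apply: bernoulli_le => //; rewrite -lamE ltW.
have lam3 : lam ^+ n <= 3.
  have : n%:R ^+ 2 * (t ^+ 2 * B ^+ 2) <= 1.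
    by rewrite -!exprMn mulrCA exprn_ile1 ?(ltW tB)// mulr_ge0// ltW.
  lra.
have t3 : t ^+ 2 / 3 * lam ^+ n <= t ^+ 2 / 3 * 3.
  by rewrite ler_pM2l// divr_gt0// exprn_gt0.
(* The first-order gain [n t eta] beats the losses [t^2 (D + G + 1)]; the last [t^2] comes from
   [lam ^+ n <= 3] in the factor [1 + t^2 / 3]. *)
have : t * (t * (D + G + 1)) < t * (n%:R * eta).
  by rewrite ltr_pM2l// (lt_le_trans t2)// ler_peMl// ltW.
move: upper aB2; rewrite aE GE => upper aB2; lra.
Qed.

(* If the inequality failed for all v in V, the affine image of the ball under
   y |-> (t b + y (1 + t S)) / lam, where S = 1 - E^T E + c s^T s, would satisfy
   all constraints and have a larger volume. *)
Lemma near_john_test n (L eta : R) : (0 < n)%N -> 0 <= L -> 0 < eta ->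
  exists2 e : R, 0 < e & forall V : set 'rV[R]_n,
    (forall v, V v -> dotv v v <= 1) -> near_john V e -> john_test V L eta.
Proof.
move=> n0 L0 eta0; have [t t0 scale] := near_john_scale n0 L0 eta0.
exists (t ^+ 2 / 3); first by rewrite divr_gt0// exprn_gt0.
move=> V V1 nj k E s b c kn EE sL cL.
apply/not_exists2P => noV.
pose S : 'M[R]_n := 1%:M - E^T *m E + c *: (s^T *m s).
pose P : 'M[R]_n := 1%:M - E^T *m E.
pose q v := dotv v v - dotv (v *m E^T) (v *m E^T) + c * dotv s v ^+ 2 + dotv b v.
have qlt v : V v -> q v < ((n - k)%:R + c * dotv s s) / n%:R - eta.
  by move=> Vv; have [//|/negP] := noV v; rewrite -ltNge.
have vS v : v *m S = v *m P + (c * dotv s v) *: s.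
  rewrite /S mulmxDr -scalemxAr mulmxA [v *m s^T]mx11_scalar -dotvE mul_scalar_mx.
  by rewrite scalerA (dotvC v).
have vP v : dotv (v *m P) v = dotv v v - dotv (v *m E^T) (v *m E^T).
  by rewrite /P mulmxBr mulmx1 dotvBl mulmxA [in RHS]dotv_mulmx trmxK dotvC.
have PP v : dotv (v *m P) (v *m P) = dotv (v *m P) v.
  have Psym : P^T = P by rewrite /P linearB /= trmx1 trmx_mul trmxK.
  have P2 : P *m P = P.
    rewrite /P mulmxBl mul1mx mulmxBr mulmx1 -mulmxA (mulmxA E) EE.
    by rewrite mul1mx subrr subr0.
  by rewrite [LHS]dotv_mulmx Psym -mulmxA P2 dotvC.
have vSv v : dotv (v *m S) v + dotv b v = q v.
  by rewrite vS dotvDl dotvZl vP /q; ring.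
have cs : `|c * dotv s s| <= L ^+ 2.
  rewrite normrM expr2; apply: ler_pM => //.
  by rewrite ger0_norm ?dotv_ge0.
have vSC v : dotv v v <= 1 -> dotv (v *m S) (v *m S) <= 2 + 2 * L ^+ 4.
  move=> v1.
  have h1 : dotv (v *m P) (v *m P) <= 1.
    by rewrite PP vP; have := dotv_ge0 (v *m E^T); lra.
  have h2 : (c * dotv s v) ^+ 2 * dotv s s <= L ^+ 4.
    have sv : dotv s v ^+ 2 <= L.
      apply: le_trans (dotv_sqr_le _ _) _; rewrite -[leRHS]mulr1.
      by apply: ler_pM => //; exact: dotv_ge0.
    have cc : c ^+ 2 <= L ^+ 2 by rewrite -real_normK ?num_real// lerXn2r// nnegrE.
    rewrite exprMn (_ : L ^+ 4 = L ^+ 2 * L * L); last ring.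
    apply: ler_pM => //; [|exact: dotv_ge0|].
      by apply: mulr_ge0; exact: sqr_ge0.
    by apply: ler_pM => //; exact: sqr_ge0.
  have h3 : dotv (v *m S) (v *m S) <=
      2 * dotv (v *m P) (v *m P) + 2 * ((c * dotv s v) ^+ 2 * dotv s s).
    rewrite vS; set x := v *m P; set y := _ *: s.
    rewrite (_ : _ ^+ 2 * _ = dotv y y); last by rewrite /y dotvZl dotvZr mulrA.
    have := dotv_ge0 (x - y); rewrite dotvBl !dotvBr dotvDl !dotvDr (dotvC y x); lra.
  lra.
have u0 : 0 <= t / (1 + t) <= t.
  have tp : 0 < 1 + t by lra.
  apply/andP; split; first by apply: divr_ge0; exact: ltW.
  by rewrite ler_pdivrMr//; have := sqr_ge0 t; lra.
have mn : 0 <= ((n - k)%:R : R) <= n%:R by rewrite ler0n ler_nat leq_subr.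
(* The rank-one factor in [det_1Dpert] is [1 + t c <s, s>] up to second order, since its correction
   carries [t / (1 + t) <= t]. *)
have XE : `|1 + t * c * (dotv s s - t / (1 + t) *
      (dotv s s - dotv (s *m E^T) (s *m E^T))) - 1 - t * (c * dotv s s)| <=
    t ^+ 2 * L ^+ 2.
  rewrite (_ : _ - _ = t * (c * (t / (1 + t) *
      (dotv (s *m E^T) (s *m E^T) - dotv s s)))); last by ring.
  rewrite normrM (gtr0_norm t0) (_ : t ^+ 2 * _ = t * (t * L ^+ 2)); last by ring.
  rewrite ler_pM2l// normrM.
  have sE : `|dotv (s *m E^T) (s *m E^T) - dotv s s| <= L.
    have := PP s; rewrite vP => ps; have := dotv_ge0 (s *m P).
    have := dotv_ge0 (s *m E^T); rewrite ps ler_norml => ? ?.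
    by apply/andP; split; lra.
  rewrite (_ : t * L ^+ 2 = L * (t * L)); last by ring.
  apply: ler_pM => //; rewrite normrM; apply: ler_pM => //.
  by case/andP: u0 => u0 u1; rewrite ger0_norm.
have [lam [lamE]] : exists lam,
    lam = 1 + (t * (((n - k)%:R + c * dotv s s) / n%:R - eta) +
      t ^+ 2 * (2 + 2 * L ^+ 4)) /\ 0 < lam.
  by eexists; split=> //; have [] := scale _ _ _ _ mn cs XE erefl.
move=> lam0; have [_ X0] := scale _ _ _ _ mn cs XE lamE.
apply/negP; rewrite -leNgt.
have Ssym : S^T = S.
  by rewrite /S linearD linearB linearZ /= trmx1 !trmx_mul !trmxK.
have := nj (lam^-1 *: (1%:M + t *: S)) ((t / lam) *: b).
have hyp v y : V v -> dotv y y <= 1 ->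
    dotv ((t / lam) *: b + y *m (lam^-1 *: (1%:M + t *: S))) v <= 1.
  move=> Vv y1; have v1 := V1 _ Vv.
  rewrite -scalemxAr dotvDl !dotvZl -[_ / lam * _]mulrA mulrCA -mulrDr mulrC.
  rewrite ler_pdivrMr// mul1r dotv_mulmx linearD linearZ /= Ssym trmx1.
  (* Using [<y, w> <= (<y, y> + <w, w>) / 2] with [w = v (1 + t S)] avoids square roots and costs
     only a [t^2] term. *)
  apply: le_trans (lerD (lexx _) (dotv_le_half _ _)) _.
  rewrite mulmxDr mulmx1 -scalemxAr dotvDl !dotvDr !dotvZl !dotvZr (dotvC v).
  have h1 := ltW (qlt _ Vv); rewrite -vSv -(ler_pM2l t0) in h1.
  have h2 := vSC _ v1; rewrite -(ler_pM2l (exprn_gt0 2 t0)) in h2.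
  have h3 : 0 <= t ^+ 2 * dotv (v *m S) (v *m S).
    by rewrite mulr_ge0 ?sqr_ge0 ?dotv_ge0.
  rewrite lamE; move: h1 h2 h3; lra.
move=> /(_ hyp); rewrite detZ normrM ger0_norm ?exprn_ge0 ?invr_ge0 ?(ltW lam0)//.
rewrite exprVn mulrC ler_pdivrMr ?exprn_gt0//; apply: le_trans.
apply: le_trans (ler_norm _); rewrite det_1Dpert ?(ltW t0)//.
by rewrite ler_wpM2r// bernoulli_ge// ltW.
Qed.

End near_john.

(** * Selecting half-spaces *)

Section john.
Variable R : realType.

(** Shrink a longer [x] to [y] with [|y| = 2n], which still satisfies all constraints. The test with
    [E = 1], [s = y], [c = 1] and [b = (2n - 1) y] gives [4n - eta <= f^2 + (2n - 1) f] for
    [f = <y, v>]. Since [-2n <= f <= 1], the right-hand side [2n - (1 - f) (2n + f)] is at most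
    [2n], a contradiction. *)
Lemma john_test_bounded n (V : set 'rV[R]_n) (L eta : R) (x : 'rV_n) :
  (0 < n)%N -> (2 * n%:R) ^+ 2 <= L -> eta <= 1 ->
  (forall v, V v -> dotv v v <= 1) -> john_test V L eta ->
  (forall v, V v -> dotv x v <= 1) -> dotv x x <= (2 * n%:R) ^+ 2.
Proof.
move=> n0 nL eta1 V1 jt xV; rewrite leNgt; apply/negP => xn.
have N1 : 1 <= n%:R :> R by rewrite ler1n.
set N : R := n%:R in N1 nL xn *.
have x0 : 0 < dotv x x by apply: le_lt_trans xn; rewrite sqr_ge0.
pose r := Num.sqrt (dotv x x).
have r0 : 0 < r by rewrite sqrtr_gt0.
have rE : r ^+ 2 = dotv x x by rewrite sqr_sqrtr// ltW.
pose a := 2 * N / r.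
have a0 : 0 < a by rewrite divr_gt0//; lra.
have a1 : a <= 1.
  rewrite ler_pdivrMr// mul1r -(@ler_pXn2r _ 2%N)// ?nnegrE ?(ltW r0)//; last lra.
  by rewrite rE ltW.
pose y := a *: x.
have yy : dotv y y = (2 * N) ^+ 2.
  rewrite /y dotvZl dotvZr mulrA -rE /a -expr2 exprMn exprVn.
  by rewrite mulfVK// gt_eqF// exprn_gt0.
have yV v : V v -> dotv y v <= 1.
  move=> /xV xv; rewrite /y dotvZl; have [f0|f0] := leP 0 (dotv x v).
    by rewrite (le_trans _ xv)// ler_piMl.
  by rewrite (@le_trans _ _ 0)// mulr_ge0_le0// ltW.
have L1 : 1 <= L by apply: le_trans nL; rewrite expr2; nra.
have EE : 1%:M *m (1%:M : 'M[R]_n)^T = 1%:M by rewrite trmx1 mulmx1.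
have yL : dotv y y <= L by rewrite yy.
have c1 : `|1 : R| <= L by rewrite normr1.
have [v Vv] := jt n 1%:M y ((2 * N - 1) *: y) 1 (leqnn n) EE yL c1.
rewrite trmx1 mulmx1 subnn add0r mul1r subrr add0r mul1r yy dotvZl -/N.
rewrite (_ : (2 * N) ^+ 2 / N = 4 * N); last by field; rewrite gt_eqF//; lra.
have := yV v Vv; have := dotv_sqr_le y v; rewrite yy.
have := V1 v Vv; set f := dotv y v => v1 fN f1.
have f2 : - (2 * N) <= f.
  have : f ^+ 2 <= (2 * N) ^+ 2.
    by apply: le_trans fN _; rewrite ler_piMr ?sqr_ge0.
  move=> h; rewrite leNgt; apply/negP => fl.
  have : 0 < (- f - 2 * N) * (- f + 2 * N) by rewrite mulr_gt0//; lra.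
  lra.
have : 0 <= (1 - f) * (2 * N + f) by rewrite mulr_ge0//; lra.
lra.
Qed.

(** [E] is the Gram-Schmidt basis of the chosen vectors and [T] their triangular coordinates. Each
    step adds [v] in front; the test with [c < 0] keeps [v] away from the span of the earlier
    vectors and [<s, v>] from being large, which controls both the determinant and [|s|]. *)
Lemma john_test_greedy n (V : set 'rV[R]_n) (L : R) k :
  (0 < n)%N -> (k <= n)%N -> 40 * n%:R <= L ->
  (forall v, V v -> dotv v v <= 1) -> john_test V L (4 * n%:R)^-1 ->
  exists (U : 'M[R]_(k, n)) (T : 'M[R]_k) (E : 'M[R]_(k, n)),
    [/\ forall i, V (row i U), U = T *m E, E *m E^T = 1%:M,
        \prod_(j < k) ((n - j)%:R / (4 * n%:R)) <= \det T ^+ 2 &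
        dotv (\sum_i row i U) (\sum_i row i U) <=
          k%:R + 36 * Num.sqrt n%:R * (Num.sqrt n%:R - Num.sqrt (n - k)%:R)].
Proof.
move=> n0 + nL V1 jt; have N1 : 1 <= n%:R :> R by rewrite ler1n.
elim: k => [_|k IH kn].
  exists 0, 0, 0; split=> [[]//||||]; rewrite ?big_ord0 ?det_mx00 ?expr1n//.
  - by apply/matrixP => -[].
  - by apply/matrixP => -[].
  - by rewrite dotv0l subn0 subrr mulr0 addr0.
have [U [T [E [UV UTE EE dT sU]]]] := IH (ltnW kn).
set s := \sum_i row i U in sU.
set r := Num.sqrt n%:R in sU *.
have r0 : 0 <= r by exact: sqrtr_ge0.
have rE : r ^+ 2 = n%:R by rewrite sqr_sqrtr//; lra.
pose m : R := (n - k)%:R.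
have m1 : 1 <= m by rewrite ler1n subn_gt0.
have mn : m <= n%:R by rewrite ler_nat leq_subr.
set g := Num.sqrt (n - k)%:R in sU *.
have gE : g ^+ 2 = m by rewrite sqr_sqrtr// -/m; lra.
have g0 : 0 < g by rewrite sqrtr_gt0 -/m; lra.
have km : k%:R = n%:R - m :> R by rewrite /m natrB ?(ltnW kn)// opprB addrC subrK.
have s40 : dotv s s <= 40 * n%:R.
  apply: le_trans sU _; rewrite -rE.
  have : 36 * r * (r - g) <= 36 * r * r.
    by rewrite ler_wpM2l ?mulr_ge0// gerBl ltW.
  rewrite km -rE; lra.
pose q := m / n%:R.
have q0 : 0 < q by rewrite divr_gt0//; lra.
have q1 : q <= 1 by rewrite ler_pdivrMr ?mul1r//; lra.
have qn : q * n%:R = m by rewrite /q mulfVK// gt_eqF//; lra.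
(* The factor 80 makes the penalty cost at most half of [m]: [|c| <s, s> <= q n / 2 = m / 2]. *)
pose c := - (q / 80).
have cL : `|c| <= L.
  rewrite /c normrN ger0_norm; lra.
have [v Vv] := jt k E s 0 c (ltnW kn) EE (le_trans s40 nL) cL.
rewrite dotv0l addr0 -/m.
set rho2 := dotv v v - _ => hv.
have etaq : (4 * n%:R)^-1 <= q / 4.
  by rewrite invfM mulrC ler_pM2r ?invr_gt0// /q ler_peMl// invr_ge0; lra.
have hq : q / 2 <= (m + c * dotv s s) / n%:R.
  rewrite ler_pdivlMr; last lra.
  have : q * dotv s s <= q * (40 * n%:R) by rewrite ler_pM2l.
  rewrite /c; lra.
have c2 : 0 <= q * dotv s v ^+ 2 by rewrite mulr_ge0 ?sqr_ge0// ltW.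
have {}hv : q / 4 <= rho2 + c * dotv s v ^+ 2 by lra.
have rho2q : q / 4 <= rho2 by move: hv; rewrite /c; lra.
have rho21 : rho2 <= 1.
  by rewrite /rho2; have := dotv_ge0 (v *m E^T); have := V1 v Vv; lra.
have svq : q * dotv s v ^+ 2 <= 80 by move: hv; rewrite /c; lra.
(* Here [q <s, v>^2 <= 80] and [q = g^2 / r^2]; 9 is the integer just above the square root of
   80. *)
have sv : dotv s v <= 9 * r / g.
  rewrite ler_pdivlMr// leNgt; apply/negP => h.
  have : (9 * r) ^+ 2 < (dotv s v * g) ^+ 2.
    have h0 : 0 <= 9 * r by rewrite mulr_ge0.
    by rewrite ltr_pXn2r// nnegrE// (le_trans h0 (ltW h)).
  rewrite !exprMn rE gE -qn.
  have : q * dotv s v ^+ 2 * n%:R <= 80 * n%:R by rewrite ler_pM2r//; lra.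
  lra.
pose rho := Num.sqrt rho2.
have rho0 : 0 < rho by rewrite sqrtr_gt0; lra.
have rhoE : rho ^+ 2 = rho2 by rewrite sqr_sqrtr//; lra.
(* The part of [v] orthogonal to the earlier vectors; its squared length [rho2] is the new factor in
   [\det T ^+ 2]. *)
pose p := v - v *m E^T *m E.
have pE : p *m E^T = 0.
  by rewrite /p mulmxBl -[X in _ - X]mulmxA EE mulmx1 subrr.
have pp : dotv p p = rho2.
  rewrite {2}/p dotvBr (dotvC p (_ *m _)) dotv_mulmx pE dotv0r subr0 /p dotvBl.
  by rewrite dotv_mulmx.
pose e := rho^-1 *: p.
have ee : e *m e^T = 1%:M.
  rewrite [LHS]mx11_scalar -dotvE /e dotvZl dotvZr pp -rhoE.
  by rewrite (_ : _ * _ = 1)//; field; rewrite gt_eqF.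
have eE : e *m E^T = 0 by rewrite /e -scalemxAl pE scaler0.
have U'E : col_mx v U = block_mx (rho%:M : 'M[R]_1) (v *m E^T) 0 T *m col_mx e E.
  rewrite mul_block_col mul0mx add0r -UTE mul_scalar_mx scalerA mulfV ?gt_eqF//.
  by rewrite scale1r subrK.
have E'E : col_mx e E *m (col_mx e E)^T = 1%:M.
  rewrite tr_col_mx mul_col_row ee eE EE.
  rewrite (_ : E *m e^T = 0) -?scalar_mx_block//.
  by rewrite -[LHS]trmxK trmx_mul trmxK eE trmx0.
have T'E : \det (block_mx (rho%:M : 'M[R]_1) (v *m E^T) 0 T) ^+ 2 = \det T ^+ 2 * rho2.
  by rewrite det_ublock det_scalar1 exprMn rhoE mulrC.
exists (col_mx v U : 'M[R]_(1 + k, n)),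
  (block_mx (rho%:M : 'M[R]_1) (v *m E^T) 0 T : 'M[R]_(1 + k)),
  (col_mx e E : 'M[R]_(1 + k, n)); split => //.
- move=> i; case: (@split_ordP 1 k i) => j ->; last by rewrite (@rowKd _ 1 k n).
  by rewrite (@rowKu _ 1 k n) (ord1 j) (_ : row 0 v = v)//; apply/rowP => l; rewrite mxE.
- rewrite big_ord_recr /= T'E; apply: ler_pM => //.
  + by apply: prodr_ge0 => j _; apply: divr_ge0 => //; rewrite mulr_ge0//; lra.
  + by rewrite (le_trans _ rho2q)// /q invfM -/m; lra.
- rewrite (_ : \sum_i _ = v + s); last first.
    rewrite (@big_split_ord _ _ _ 1 k) big_ord1 (@rowKu _ 1 k n).
    congr (_ + _); first by apply/rowP => l; rewrite mxE.
    by apply: eq_bigr => i _; rewrite (@rowKd _ 1 k n).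
  rewrite dotvDl !dotvDr (dotvC v s).
  pose g' := Num.sqrt (n - k.+1)%:R : R.
  have g'0 : 0 <= g' by exact: sqrtr_ge0.
  have g'E : g' ^+ 2 = m - 1.
    by rewrite sqr_sqrtr// /m -[in RHS]subnSK// -natr1 addrK.
  (* From [g^2 - g'^2 = 1] follows [1 / g <= 2 (g - g')], so the increment [2 <s, v> <= 18 r / g] is
     at most [36 r (g - g')] and telescopes. *)
  have : 1 <= 2 * g * (g - g').
    have := sqr_ge0 (g - g'); lra.
  move=> gg; have := V1 v Vv.
  have h : 9 * r / g <= 18 * r * (g - g').
    rewrite ler_pdivrMr//.
    have : 9 * r * 1 <= 9 * r * (2 * g * (g - g')) by rewrite ler_wpM2l// mulr_ge0.
    lra.
  rewrite -/g' -natr1; lra.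
Qed.

(* Helly's theorem for the half-spaces <x, w j> <= 1 and <x, d> > h: in a minimal
   subfamily, dropping each member j gives a witness f j, and a Radon partition of
   n + 2 witnesses yields a point of all the half-spaces. *)
Lemma halfspaces_helly n (J : finType) (w : J -> 'rV[R]_n) (d : 'rV_n) (h : R) :
  (forall x, (forall j, dotv x (w j) <= 1) -> dotv x d <= h) ->
  exists2 K : {set J}, (#|K| <= n.+1)%N &
    forall x, (forall j, j \in K -> dotv x (w j) <= 1) -> dotv x d <= h.
Proof.
move=> wd.
pose P (K : {set J}) :=
  `[< forall x, (forall j, j \in K -> dotv x (w j) <= 1) -> dotv x d <= h >].
have PT : P [set: J]%SET.
  by apply/asboolP => x xw; apply: wd => j; apply: xw; rewrite inE.
have [K /minsetP[/asboolP PK Kmin] _] := minset_exists PT.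
exists K => //; rewrite leqNgt; apply/negP => Kn.
have bad j : j \in K -> exists x,
    (forall i, i \in K -> i != j -> dotv x (w i) <= 1) /\ h < dotv x d.
  move=> jK; apply: contrapT => noX.
  have : P (K :\ j)%SET.
    apply/asboolP => x xw; rewrite leNgt; apply/negP => xd; apply: noX.
    by exists x; split => // i iK ij; apply: xw; rewrite !inE ij.
  move=> /Kmin => /(_ (subD1set _ _)) /setP /(_ j); rewrite !inE eqxx jK.
  by [].
have /choice[f fP] (i : 'I_#|K|) : exists x,
    (forall l, l \in K -> l != enum_val i -> dotv x (w l) <= 1) /\ h < dotv x d.
  exact/bad/enum_valP.
(* The appended coordinate 1 turns a linear relation into an affine one; more than [n + 1] rows of
   length [n + 1] force a relation. *)
pose X : 'M[R]_(#|K|, n + 1) := \matrix_(i, l) row_mx (f i) (1%:M : 'M[R]_1) 0 l.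
have : kermx X != 0.
  rewrite -mxrank_eq0 mxrank_ker subn_eq0 -ltnNge.
  by rewrite (leq_ltn_trans (rank_leq_col _))// addn1.
move=> /rowV0Pn[a /sub_kermxP aX a0].
have af : \sum_i a 0 i *: f i = 0.
  apply/rowP => l; rewrite summxE mxE.
  have /rowP/(_ (lshift 1 l)) := aX; rewrite !mxE => aXl; rewrite -[RHS]aXl.
  by apply: eq_bigr => i _; rewrite !mxE; case: split_ordP => l' /eqP;
     rewrite eq_shift// => /eqP ->.
have as0 : \sum_i a 0 i = 0.
  have /rowP/(_ (rshift n 0)) := aX; rewrite !mxE => aXl; rewrite -[RHS]aXl.
  apply: eq_bigr => i _; rewrite !mxE; case: split_ordP => l' /eqP;
    by rewrite eq_shift// ord1 mxE eqxx mulr1.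
have [i0 ai0] : exists i, 0 < a 0 i.
  apply: contrapT => /forallNP noi; move/eqP: a0; apply.
  have an i : 0 <= - a 0 i by rewrite oppr_ge0 leNgt; apply/negP/noi.
  have : \sum_i - a 0 i = 0 by rewrite sumrN as0 oppr0.
  move=> /psumr_eq0P sa; apply/rowP => i; rewrite mxE; apply/eqP.
  by rewrite -oppr_eq0 sa.
pose A := \sum_(i | 0 < a 0 i) a 0 i.
have A0 : 0 < A.
  by rewrite /A (bigD1 i0)//= ltr_pwDl// sumr_ge0// => i /andP[/ltW].
have AE : A = \sum_(i | ~~ (0 < a 0 i)) - a 0 i.
  move: as0; rewrite (bigID (fun i => 0 < a 0 i)) /= => /eqP.
  by rewrite addr_eq0 -sumrN => /eqP.
pose z := \sum_(i | 0 < a 0 i) a 0 i *: f i.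
have zE : z = \sum_(i | ~~ (0 < a 0 i)) (- a 0 i) *: f i.
  move: af; rewrite (bigID (fun i => 0 < a 0 i)) /= => /eqP.
  rewrite addr_eq0 -sumrN => /eqP; rewrite -/z => ->.
  by apply: eq_bigr => i _; rewrite scaleNr.
(* The Radon point [z / A] is a convex combination of either class of witnesses. For the member
   dropped at witness [k], use the class without [k], all of whose witnesses satisfy that
   constraint. *)
have zw j : j \in K -> dotv (A^-1 *: z) (w j) <= 1.
  move=> jK; rewrite dotvZl mulrC ler_pdivrMr// mul1r.
  have [k jE] : exists k : 'I_#|K|, j = enum_val k.
    by exists (enum_rank_in jK j); rewrite enum_rankK_in.
  have [ak|ak] := boolP (0 < a 0 k).
    rewrite zE AE dotv_suml; apply: ler_sum => i ai; rewrite dotvZl.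
    have an : 0 <= - a 0 i by rewrite oppr_ge0 leNgt.
    rewrite ler_piMr//; apply: (fP i).1 => //.
    by apply: contraNneq ai; rewrite jE => /enum_val_inj <-.
  rewrite /z /A dotv_suml; apply: ler_sum => i ai; rewrite dotvZl.
  rewrite ler_piMr ?(ltW ai)//; apply: (fP i).1 => //.
  by apply: contraNneq ak; rewrite jE => /enum_val_inj ->.
have := PK _ zw; rewrite leNgt => /negP; apply.
rewrite dotvZl mulrC ltr_pdivlMr// /z /A dotv_suml mulr_sumr.
rewrite (bigD1 i0)//= [X in _ < X](bigD1 i0)//= ltr_leD//.
  by rewrite dotvZl mulrC ltr_pM2l//; exact: (fP i0).2.
apply: ler_sum => i /andP[ai _]; rewrite dotvZl mulrC ler_pM2l//.
exact/ltW/(fP i).2.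
Qed.

(** * Compactness *)

Lemma continuous_dotv n (f g : 'rV[R]_n -> 'rV[R]_n) :
  continuous f -> continuous g -> continuous (fun x => dotv (f x) (g x)).
Proof.
move=> cf cg.
suff H (l : seq 'I_n) : continuous (fun x => \sum_(i <- l) f x 0 i * g x 0 i).
  exact: H.
have coord (h : 'rV[R]_n -> 'rV[R]_n) i : continuous h -> continuous (fun x => h x 0 i).
  move=> ch x; apply: (@continuous_comp _ _ _ h (fun M : 'rV[R]_n => M 0 i)).
    exact: ch.
  exact: coord_continuous.
elim: l => [|i l IH].
  rewrite (_ : (fun x => _) = cst 0); first exact: cst_continuous.
  by apply/funext => x; rewrite big_nil.
rewrite (_ : (fun x => _) = (fun x => f x 0 i * g x 0 i) \+
    (fun x => \sum_(i <- l) f x 0 i * g x 0 i)).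
  move=> x; apply: continuousD; last exact: IH.
  by apply: continuousM; exact: coord.
by apply/funext => x; rewrite big_cons.
Qed.

Lemma sphere_compact n (r : R) : compact [set x : 'rV[R]_n | dotv x x = r].
Proof.
apply: bounded_closed_compact.
  exists (1 + r); split; first exact: num_real.
  move=> M rM x /= xr; rewrite [leLHS]mx_normrE; apply/bigmax_leP => /=; split.
    by have := dotv_ge0 x; rewrite xr; lra.
  move=> [i j] _ /=; rewrite (ord1 i).
  have : x 0 j ^+ 2 <= r.
    rewrite -xr /dotv (bigD1 j)//= expr2 lerDl sumr_ge0// => l _.
    by rewrite -expr2 sqr_ge0.
  have := sqr_ge0 (1 - `|x 0 j|); rewrite sqrrB real_normK ?num_real// => h1 h2.
  rewrite expr1n mul1r in h1; have := normr_ge0 (x 0 j); lra.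
rewrite (_ : [set x | _] = (fun x : 'rV[R]_n => dotv x x) @^-1` [set r])//.
apply: closed_comp; last exact: closed_eq.
move=> x _; apply: (@continuous_dotv n id id) => y; exact: cvg_id.
Qed.

(** The open sets [1 < <x, v>] cover the sphere [|x|^2 = b], and a finite subcover is kept. A longer
    [x] satisfying the kept constraints could be shrunk onto the sphere without violating them. *)
Lemma finite_halfspaces_bounded n (V : set 'rV[R]_n) (a b : R) : 0 <= a -> a < b ->
  (forall x, (forall v, V v -> dotv x v <= 1) -> dotv x x <= a) ->
  exists2 F : seq 'rV[R]_n, (forall v, v \in F -> V v) &
    forall x, (forall v, v \in F -> dotv x v <= 1) -> dotv x x <= b.
Proof.
move=> a0 ab Va.
have := @sphere_compact n b; rewrite compact_cover.
move=> /(_ _ V (fun v => [set x | 1 < dotv x v])); case.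
- move=> v _.
  rewrite (_ : [set x | _] = (fun x : 'rV[R]_n => dotv x v) @^-1` [set y | 1 < y])//.
  apply: open_comp; last exact: open_gt.
  move=> x _; apply: (@continuous_dotv n id (cst v)) => y.
    exact: cvg_id.
  exact: cst_continuous.
- move=> x /= xb; apply: contrapT => nx.
  suff : dotv x x <= a by rewrite xb leNgt ab.
  apply: Va => v Vv.
  by rewrite leNgt; apply/negP => xv; apply: nx; exists v.
- move=> F FV Fc; exists (finmap.enum_fset F) => [v /FV|x xF]; first by rewrite inE.
  rewrite leNgt; apply/negP => xb.
  have b0 : 0 < b by apply: le_lt_trans ab.
  have x0 : 0 < dotv x x by apply: lt_trans xb.
  pose c := Num.sqrt (b / dotv x x).
  have cE : c ^+ 2 * dotv x x = b by rewrite sqr_sqrtr ?mulfVK ?gt_eqF// divr_ge0// ltW.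
  have c0 : 0 <= c by exact: sqrtr_ge0.
  have c1 : c <= 1.
    by rewrite -sqrtr1 ler_wsqrtr// ler_pdivrMr// mul1r ltW.
  have /Fc[v /= vF] : dotv (c *: x) (c *: x) = b by rewrite dotvZl dotvZr mulrA.
  rewrite dotvZl ltNge => /negP; apply.
  have := xF v vF; have [f0 xv|f0 _] := leP 0 (dotv x v).
    by rewrite (le_trans _ xv)// ler_piMl.
  by rewrite (@le_trans _ _ 0)// mulr_ge0_le0// ltW.
Qed.

End john.

(** * The volume bound in near-John position *)

Section core.
Variable R : realType.

(** A substitute for Stirling's formula: [n^n] is at most the falling factorial of [2n] of length
    [n], which is [n!] times a binomial coefficient of at most [4^n]. *)
Lemma expnn_le_fact n : (n ^ n <= 4 ^ n * n`!)%N.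
Proof.
have H m : (m <= n)%N -> (n ^ m <= (n + n) ^_ m)%N.
  elim: m => [//|m IH] mn; rewrite expnSr ffactnSr leq_mul ?IH ?(ltnW mn)//.
  by rewrite -addnBA ?leq_addr// ltnW.
apply: leq_trans (H n (leqnn n)) _; rewrite -bin_ffact leq_mul2r.
apply/orP; right; rewrite (_ : 4 = 2 ^ 2)%N// -expnM mul2n -addnn.
have := Pascal 1 1 (n + n); rewrite addn1 => ->.
rewrite (bigD1 (inord n)) //= inordK ?ltnS ?leq_addr// !exp1n !muln1.
exact: leq_addr.
Qed.

(** The greedy vectors map the selected intersection by [x |-> 1 - <x, u_i>] into a simplex: the
    coordinates are nonnegative and sum to [n - <x, s>], which the [n + 1] Helly half-spaces bound
    by [n + h]. *)
Lemma john_halfspaces n (V : set 'rV[R]_n) (L := (2 * n%:R) ^+ 2 + 40 * n%:R : R) :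
  (0 < n)%N -> (forall v, V v -> dotv v v <= 1) -> john_test V L (4 * n%:R)^-1 ->
  exists s : seq 'rV[R]_n, [/\ (size s <= n + n.+1)%N,
    forall v, v \in s -> V v &
    (volume [set x | forall v, v \in s -> (dotv x v <= 1)%R]
      <= ((320 * Num.sqrt n%:R) ^+ n)%:E)%E].
Proof.
move=> n0 V1 jt; have N1 : 1 <= n%:R :> R by rewrite ler1n.
set r : R := Num.sqrt n%:R.
have rE : r ^+ 2 = n%:R by rewrite sqr_sqrtr//; lra.
have r0 : 0 < r by rewrite sqrtr_gt0; lra.
have r1 : 1 <= r by rewrite -sqrtr1 ler_wsqrtr.
have etaq : (4 * n%:R)^-1 <= 1 :> R by rewrite invf_le1//; lra.
have VB x : (forall v, V v -> dotv x v <= 1) -> dotv x x <= (2 * n%:R) ^+ 2.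
  by apply: john_test_bounded jt => //; rewrite /L lerDl mulr_ge0.
have nL : 40 * n%:R <= L by rewrite /L lerDr sqr_ge0.
have [U [T [E [UV UTE EE dT]]]] := john_test_greedy n0 (leqnn n) nL V1 jt.
rewrite subnn sqrtr0 subr0 -/r -mulrA -expr2 rE.
set s := \sum_i row i U => sn.
(* Compactness asks for a strictly larger radius, so [2n] is relaxed to [3n]. *)
have n23 : (2 * n%:R) ^+ 2 < (3 * n%:R) ^+ 2 :> R.
  by rewrite !exprMn ltr_pM2r ?exprn_gt0//; lra.
have [F FV FB] := finite_halfspaces_bounded (sqr_ge0 _) n23 VB.
(* [|x| <= 3n] and [|s|^2 <= 37 n] give [<x, s>^2 <= 333 n^3], below [(19 n r)^2 = 361 n^3]. *)
pose h := 19 * n%:R * r.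
have Fh x : (forall j : seq_sub F, dotv x (val j) <= 1) -> dotv x (- s) <= h.
  move=> xF; have xx : dotv x x <= (3 * n%:R) ^+ 2.
    by apply: FB => v vF; exact: (xF (SeqSub vF)).
  have h0 : 0 <= h by rewrite /h !mulr_ge0// ltW.
  rewrite leNgt; apply/negP => hx.
  have : h ^+ 2 < dotv x (- s) ^+ 2.
    by rewrite ltr_pXn2r// nnegrE// (le_trans h0 (ltW hx)).
  apply/negP; rewrite -leNgt; apply: le_trans (dotv_sqr_le _ _) _.
  rewrite dotvNl dotvNr opprK.
  apply: (@le_trans _ _ ((3 * n%:R) ^+ 2 * (37 * n%:R))).
    by apply: ler_pM => //; rewrite ?dotv_ge0//; lra.
  rewrite /h !exprMn rE.
  have : 0 <= n%:R ^+ 2 * n%:R :> R by rewrite mulr_ge0.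
  lra.
have [K Kn Kh] := halfspaces_helly Fh.
exists (codom (fun i : ordinal n => row i U) ++ [seq val j | j <- enum K]); split.
- by rewrite size_cat size_codom card_ord size_map -cardE leq_add2l.
- move=> v; rewrite mem_cat => /orP[/codomP[i ->]|/mapP[j _ ->]]; first exact: UV.
  by apply: FV; exact: valP.
(* The greedy product is [n! / (4n)^n], and [n^n <= 4^n n!]. *)
have detT2 : 16 ^- n <= \det T ^+ 2.
  apply: le_trans dT; rewrite big_split /= prodr_const card_ord -natr_prod.
  rewrite -ffact_prod ffactnn exprVn ler_pdivlMr ?exprn_gt0 ?mulr_gt0//; last lra.
  rewrite mulrC ler_pdivrMr ?exprn_gt0// (_ : 16 = 4 * 4 :> R); last lra.
  rewrite !exprMn mulrCA ler_pM2l ?exprn_gt0//.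
  by rewrite -!natrX -natrM ler_nat mulnC expnn_le_fact.
have detU : \det U ^+ 2 = \det T ^+ 2.
  rewrite UTE det_mulmx exprMn -[X in _ * X](_ : 1 = _) ?mulr1//.
  by rewrite -(det1 R n) -EE det_mulmx det_tr expr2.
have detU4 : 4 ^- n <= `|\det U|.
  rewrite -(@ler_pXn2r _ 2%N)// ?nnegrE ?invr_ge0 ?exprn_ge0//.
  rewrite real_normK ?num_real// detU exprVn -exprM mulnC exprM.
  by rewrite (_ : 4 ^+ 2 = 16 :> R)//; lra.
have dU : \det U != 0 by rewrite -normr_gt0 (lt_le_trans _ detU4)// invr_gt0 exprn_gt0.
pose M := - U^T; pose c : 'rV[R]_n := const_mx 1.
apply: (@le_trans _ _ (volume [set x | simplex (n%:R + h) (x *m M + c)])).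
  apply: le_volume.
  - exact: (measurable_rV_polar (fun v => v \in _)).
  - exact: (measurable_rV_affine M c (measurable_rV_simplex (n%:R + h))).
  - move=> x /= xs.
    have cE i : (x *m M + c) 0 i = 1 - dotv x (row i U).
      rewrite /M /c !mxE addrC /dotv -sumrN; congr (_ + _); apply: eq_bigr => l _.
      by rewrite !mxE mulrN.
    have xU i : dotv x (row i U) <= 1.
      by apply: xs; rewrite mem_cat (codom_f (fun i : ordinal n => row i U)).
    split=> [i|]; first by rewrite cE subr_ge0.
    under eq_bigr do rewrite cE.
    rewrite sumrB sumr_const card_ord lerD2l -dotv_sumr -dotvNr; apply: Kh => j jK.
    by apply: xs; rewrite mem_cat (map_f val) ?orbT ?mem_enum.
have dM : `|\det M| = `|\det U|.
  by rewrite /M -scaleN1r detZ det_tr normrM normrX normrN1 expr1n mul1r.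
have nh0 : 0 <= n%:R + h by rewrite addr_ge0// /h !mulr_ge0// ltW.
rewrite volume_affine; last exact: measurable_rV_simplex; last first.
  by rewrite -normr_gt0 dM normr_gt0.
rewrite volume_simplex// -EFinM lee_fin dM.
have nhr : n%:R + h <= 20 * r ^+ 3.
  rewrite /h -rE.
  have : r ^+ 2 * 1 <= r ^+ 2 * r by rewrite ler_pM2l// exprn_gt0.
  lra.
(* The three factors bound [1 / |det U|], [(n + h)^n] and [1 / n!]; together they give
   [4 * 20 * 4 = 320]. *)
apply: (@le_trans _ _ (4 ^+ n * ((20 * r ^+ 3) ^+ n * (4 / r ^+ 2) ^+ n))).
  apply: ler_pM; rewrite ?invr_ge0 ?mulr_ge0 ?exprn_ge0 ?invr_ge0//.
    rewrite -[4 ^+ n]invrK lef_pV2 // posrE.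
      by rewrite normr_gt0.
    by rewrite invr_gt0 exprn_gt0.
  apply: ler_pM; rewrite ?invr_ge0 ?exprn_ge0//.
    by rewrite lerXn2r// nnegrE// mulr_ge0// exprn_ge0// ltW.
  rewrite rE exprMn exprVn ler_pdivlMr ?exprn_gt0//; last lra.
  rewrite mulrC ler_pdivrMr ?ltr0n ?fact_gt0//.
  by rewrite -!natrX -natrM ler_nat expnn_le_fact.
rewrite -!exprMn (_ : 4 * _ = 320 * r)//; field; rewrite gt_eqF//.
Qed.

End core.

(** * Near-maximal ellipsoids and the reduction to John position *)

Section main.
Variable R : realType.

Definition ellipsoid_in n (I : Type) (v : I -> 'rV[R]_n) (A : 'M[R]_n) (z : 'rV[R]_n) :=
  forall i y, dotv y y <= 1 -> dotv (z + y *m A) (v i) <= 1.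

(** The body contains a simplex with vertices [x0] and [x0 + row i A]. With [c = 1 / (2n)], a ball
    point [y] goes to [x0 + c \sum_k (1 + y_k) row k A], whose coefficients are nonnegative and sum
    to at most 1. *)
Lemma ellipsoid_in_exists n (I : Type) (v : I -> 'rV[R]_n) : (0 < n)%N ->
  (0 < volume (\bigcap_(i : I) halfspace (v i)))%E ->
  exists A z, ellipsoid_in v A z /\ \det A != 0.
Proof.
move=> n0 P0; have N1 : 1 <= n%:R :> R by rewrite ler1n.
have [x0 [A [dA Px0 PA]]] := volume_gt0_span (measurable_rV_bigcap_halfspace v) P0.
pose c : R := (2 * n%:R)^-1.
have c0 : 0 < c by rewrite invr_gt0; lra.
exists (c *: A), (x0 + c *: \sum_i row i A); split; last first.
  by rewrite detZ mulf_neq0// expf_neq0// gt_eqF.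
move=> i y y1; rewrite -scalemxAr mulmx_sum_row -addrA -scalerDr -big_split /=.
have f1 : dotv x0 (v i) <= 1 by exact: Px0.
rewrite dotvDl dotvZl dotv_suml.
have yk k : -1 <= y 0 k <= 1.
  have : y 0 k ^+ 2 <= 1.
    apply: le_trans y1; rewrite /dotv (bigD1 k)//= expr2 lerDl sumr_ge0// => l _.
    by rewrite -expr2 sqr_ge0.
  by rewrite -real_normK ?num_real// expr_le1// ler_norml.
have : \sum_k dotv (row k A + y 0 k *: row k A) (v i) <=
    \sum_(k < n) 2 * (1 - dotv x0 (v i)).
  apply: ler_sum => k _; rewrite dotvDl dotvZl.
  have := PA k i Logic.I; rewrite /halfspace /= dotvDl => g1.
  have /andP[y1' y2'] := yk k.
  have h1 : 0 <= (1 + y 0 k) * (1 - dotv x0 (v i) - dotv (row k A) (v i)).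
    by rewrite mulr_ge0//; lra.
  have h2 : 0 <= (1 - y 0 k) * (1 - dotv x0 (v i)) by rewrite mulr_ge0//; lra.
  lra.
rewrite sumr_const card_ord -(ler_pM2l c0) => h.
have : c * ((2 * (1 - dotv x0 (v i))) *+ n) = 1 - dotv x0 (v i).
  by rewrite -mulr_natr /c; field; rewrite gt_eqF//; lra.
move: h; lra.
Qed.

(** The unit ball contains the cube of half-side [1 / sqrt n]. The estimate bounds [|det A|] from
    above and, later, the volume of the body from below. *)
Lemma volume_ellipsoid_in n (I : Type) (v : I -> 'rV[R]_n) A z : (0 < n)%N ->
  ellipsoid_in v A z -> \det A != 0 ->
  ((`|\det A| * (2 / Num.sqrt n%:R) ^+ n)%:E <=
    volume (\bigcap_(i : I) halfspace (v i)))%E.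
Proof.
move=> n0 vA dA; have N1 : 1 <= n%:R :> R by rewrite ler1n.
set r : R := Num.sqrt n%:R.
have rE : r ^+ 2 = n%:R by rewrite sqr_sqrtr//; lra.
have r0 : 0 < r by rewrite sqrtr_gt0; lra.
have uA : A \in unitmx by rewrite unitmxE unitfE.
pose B : set 'rV[R]_n := [set y | forall i,
  (const_mx (- r^-1) : 'rV_n) 0 i <= y 0 i <= (const_mx r^-1 : 'rV_n) 0 i].
have mB : measurable_rV B.
  pose D : set (measurableTypeR R) := `[- r^-1, r^-1]%classic.
  rewrite (_ : B = [set x | forall i, D (x 0 i)]).
    by apply: (@measurable_rV_coord R n (fun=> D)) => i; exact: (measurable_itv `[- r^-1, r^-1]).
  by apply/seteqP; split=> x /= + i => /(_ i); rewrite /D /= in_itv /= !mxE.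
have vB : volume B = ((2 / r) ^+ n)%:E.
  rewrite volume_box => [|i]; last by rewrite !mxE ge0_cp// invr_ge0 ltW.
  rewrite (eq_bigr (fun=> 2 / r)); first by rewrite prodr_const card_ord.
  by move=> i _; rewrite !mxE; ring.
pose z' := - (z *m invmx A).
rewrite EFinM -vB -[`|\det A|]invrK -normfV -det_inv -(volume_affine z')//; last first.
  by rewrite det_inv invr_eq0.
apply: le_volume; first exact: measurable_rV_affine.
  exact: measurable_rV_bigcap_halfspace.
move=> x /= xB i _; rewrite /halfspace /=.
set y := x *m invmx A + z' in xB.
have -> : x = z + y *m A.
  by rewrite /y /z' mulmxDl mulNmx !mulmxKV// addrC subrK.
apply: vA; rewrite /dotv.
apply: (@le_trans _ _ (\sum_(i < n) n%:R^-1)).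
  apply: ler_sum => k _; have := xB k; rewrite !mxE -ler_norml => yk.
  rewrite -expr2 -rE -real_normK ?num_real// -exprVn lerXn2r// nnegrE// invr_ge0 ltW//.
by rewrite sumr_const card_ord -[_ *+ n]mulr_natr mulVf// gt_eqF//; lra.
Qed.

(** The finite volume of the body bounds [|det A|], so the supremum is finite; a value within the
    factor [1 + e] of it is chosen. *)
Lemma ellipsoid_in_near_max n (I : Type) (v : I -> 'rV[R]_n) (e : R) : (0 < n)%N ->
  0 < e -> (0 < volume (\bigcap_(i : I) halfspace (v i)) < +oo)%E ->
  exists A z, [/\ ellipsoid_in v A z, \det A != 0 &
    forall A' z', ellipsoid_in v A' z' -> `|\det A'| <= (1 + e) * `|\det A|].
Proof.
move=> n0 e0 /andP[P0 Poo].
pose D := [set `|\det A| | A in [set A | exists z, ellipsoid_in v A z]].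
have [A0 [z0 [vA0 dA0]]] := ellipsoid_in_exists n0 P0.
have r0 : 0 < 2 / Num.sqrt n%:R :> R by rewrite divr_gt0// sqrtr_gt0 ltr0n.
have Dub : has_ubound D.
  exists (fine (volume (\bigcap_(i : I) halfspace (v i))) / (2 / Num.sqrt n%:R) ^+ n).
  move=> _ [A [z vA] <-].
  have [->|dA] := eqVneq (\det A) 0.
    by rewrite normr0 divr_ge0 ?exprn_ge0 ?(ltW r0)// fine_ge0// ltW.
  rewrite ler_pdivlMr ?exprn_gt0// -lee_fin fineK; first exact: volume_ellipsoid_in vA dA.
  by rewrite ge0_fin_numE// ltW.
have Dsup : has_sup D by split => //; exists `|\det A0|, A0 => //; exists z0.
have d0 : 0 < `|\det A0| by rewrite normr_gt0.
have s0 : 0 < sup D.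
  by rewrite (lt_le_trans d0)//; apply: ub_le_sup => //; exists A0 => //; exists z0.
have e1 : 0 < 1 + e by lra.
have [|_ [A [z vA] <-] dA] := @sup_adherent _ D (sup D * (e / (1 + e))) _ Dsup.
  by rewrite mulr_gt0// divr_gt0.
have dE : sup D - sup D * (e / (1 + e)) = sup D / (1 + e) by field; rewrite gt_eqF.
rewrite dE ltr_pdivrMr// mulrC in dA.
exists A, z; split => //.
  by rewrite -normr_gt0 -(pmulr_rgt0 _ e1) (lt_trans s0).
move=> A' z' vA'; apply: le_trans (ltW dA).
by apply: ub_le_sup => //; exists A' => //; exists z'.
Qed.

End main.

Theorem theorem1p4 (R : realType) :
  exists alpha C : R, [/\ 1 < alpha, 0 < C &
    forall (n : nat) (I : Type) (v : I -> 'rV[R]_n), (1 <= n)%N ->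
      (0 < volume (\bigcap_(i : I) halfspace (v i)))%E ->
      exists (s : nat) (j : 'I_s -> I), s%:R <= alpha * n%:R /\
        (volume (\bigcap_(k : 'I_s) halfspace (v (j k))) <=
         ((C * n%:R) ^+ n)%:E * volume (\bigcap_(i : I) halfspace (v i)))%E].
Proof.
(* [alpha = 3] because [2n + 1 <= 3n]; [160 n] is the quotient of [320 sqrt n] by the cube side
   [2 / sqrt n]. *)
exists 3, 160; split; [lra|lra|] => n I v n0 P0.
have N1 : 1 <= n%:R :> R by rewrite ler1n.
(* In infinite volume the empty subfamily works, the right-hand side being [+oo]. *)
have [Poo|Poo] := leP +oo%E (volume (\bigcap_(i : I) halfspace (v i))).
  have j0 : 'I_0 -> I by case.
  exists 0%N, j0; split; first by rewrite mulr_ge0.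
  move: Poo; rewrite leye_eq => /eqP ->.
  by rewrite gt0_muley ?leey// lte_fin exprn_gt0// mulr_gt0//; lra.
pose L : R := (2 * n%:R) ^+ 2 + 40 * n%:R.
have L0 : 0 <= L by rewrite addr_ge0// ?sqr_ge0// mulr_ge0.
have eta0 : 0 < (4 * n%:R)^-1 :> R by rewrite invr_gt0; lra.
have [e e0 test] := near_john_test n0 L0 eta0.
have [A [z [vA dA Amax]]] : exists A z, [/\ ellipsoid_in v A z, \det A != 0 &
    forall A' z', ellipsoid_in v A' z' -> `|\det A'| <= (1 + e) * `|\det A|].
  by apply: ellipsoid_in_near_max => //; rewrite P0.
have uA : A \in unitmx by rewrite unitmxE unitfE.
pose d i := 1 - dotv z (v i).
pose w i := v i *m A^T.
(* Test the ellipsoid at its farthest point in direction [v i], namely [y = w i / |w i|], or at its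
   centre if [w i = 0]. *)
have wd i : Num.sqrt (dotv (w i) (w i)) <= d i.
  set m := Num.sqrt _.
  have m2 : m ^+ 2 = dotv (w i) (w i) by rewrite sqr_sqrtr// dotv_ge0.
  have [m0|m0] := eqVneq m 0.
    have := vA i 0; rewrite mul0mx addr0 dotv0l => /(_ ler01).
    by rewrite m0 /d subr_ge0.
  have := vA i (m^-1 *: w i); rewrite dotvZl dotvZr -m2 -scalemxAl dotvDl dotvZl.
  rewrite dotv_mulmx -/(w i) -m2 (_ : m^-1 * (m^-1 * m ^+ 2) = 1); last by field.
  rewrite (_ : m^-1 * m ^+ 2 = m); last by field.
  by move=> /(_ (lexx _)); rewrite /d; lra.
have d0 i : 0 < d i.
  have s0 := sqrtr_ge0 (dotv (w i) (w i)).
  rewrite lt_neqAle (le_trans s0 (wd i)) andbT eq_sym; apply/eqP => di.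
  have := wd i; rewrite di => s0'.
  have /eqP : Num.sqrt (dotv (w i) (w i)) == 0 by rewrite eq_le s0' s0.
  move=> /eqP; rewrite sqrtr_eq0 => w0.
  have /eqP : dotv (w i) (w i) == 0 by rewrite eq_le w0 dotv_ge0.
  move=> /eqP; rewrite dotv_eq0 /w => /eqP wi0.
  have vi0 : v i = 0 by rewrite -[v i](@mulmxK _ _ _ A^T) ?unitmx_tr// wi0 mul0mx.
  by move: di; rewrite /d vi0 dotv0r; lra.
(* In the coordinates [x |-> z + x A] the half-space of [v i] becomes [<x, w i / d i> <= 1] and the
   ellipsoid becomes the unit ball. *)
pose V := range (fun i => (d i)^-1 *: w i).
have V1 u : V u -> dotv u u <= 1.
  move=> [i _ <-]; rewrite dotvZl dotvZr mulrA -invfM ler_pdivrMl ?mulr_gt0// mulr1.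
  rewrite -expr2 -[leLHS]sqr_sqrtr ?dotv_ge0// lerXn2r// nnegrE ?sqrtr_ge0//.
  exact: ltW.
have half i x : dotv (z + x *m A) (v i) <= 1 <-> dotv x ((d i)^-1 *: w i) <= 1.
  rewrite dotvDl dotv_mulmx -/(w i) dotvZr ler_pdivrMl// mulr1 /d.
  by rewrite lerBrDl.
(* An ellipsoid in the new coordinates composes with [x |-> z + x A] to one in the body; dividing by
   [|det A|] turns near-maximality into [near_john]. *)
have nj : near_john V e.
  move=> A' z' Vz'; rewrite -(@ler_pM2r _ `|\det A|) ?normr_gt0//.
  rewrite -normrM -det_mulmx; apply: (Amax _ (z + z' *m A)) => i y y1.
  rewrite mulmxA -addrA -mulmxDl; apply/half.
  by apply: Vz' => //; exists i.
have jt : john_test V L (4 * n%:R)^-1 by exact: test.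
have [s [sn sV sQ]] := john_halfspaces n0 V1 jt.
have /choice[j jP] (k : 'I_(size s)) : exists i : I, (d i)^-1 *: w i = s`_k.
  by have [i _ <-] := sV _ (mem_nth 0 (ltn_ord k)); exists i.
exists (size s), j; split.
  rewrite -natrM ler_nat (leq_trans sn)// -addn1 !mulSn mul0n addn0.
  by rewrite !leq_add2l.
pose Q := [set x : 'rV[R]_n | forall u, u \in s -> dotv x u <= 1].
have mQ : measurable_rV Q by exact: measurable_rV_polar.
have -> : \bigcap_(k : 'I_(size s)) halfspace (v (j k)) =
    [set x | Q (x *m invmx A + - (z *m invmx A))].
  apply/seteqP; split=> x /= xQ.
    move=> u /nthP-/(_ 0)[k ks <-]; rewrite -(jP (Ordinal ks)).
    apply/half; rewrite mulmxDl mulNmx !mulmxKV// addrC subrK.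
    exact: (xQ (Ordinal ks)).
  move=> k _; rewrite /halfspace /=.
  have := xQ _ (mem_nth 0 (ltn_ord k)); rewrite -jP => /half.
  by rewrite mulmxDl mulNmx !mulmxKV// addrC subrK.
rewrite volume_affine//; last by rewrite det_inv invr_eq0.
rewrite det_inv normfV invrK.
have r0 : 0 < Num.sqrt n%:R :> R by rewrite sqrtr_gt0 ltr0n.
have rE : Num.sqrt n%:R ^+ 2 = n%:R :> R by rewrite sqr_sqrtr.
have vP := volume_ellipsoid_in n0 vA dA.
have C0 : 0 <= (160 * n%:R) ^+ n :> R by rewrite exprn_ge0// mulr_ge0.
apply: (@le_trans _ _ (`|\det A|%:E * ((320 * Num.sqrt n%:R) ^+ n)%:E)%E).
  by rewrite lee_wpmul2l// lee_fin.
apply: le_trans (lee_wpmul2l _ vP); last by rewrite lee_fin.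
rewrite -!EFinM lee_fin mulrCA -exprMn.
set r := Num.sqrt n%:R in rE r0 *; rewrite -rE.
by rewrite (_ : 160 * _ * _ = 320 * r)//; field; rewrite gt_eqF.
Qed.
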